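(* Let $(f,\mu)$ be a system as in the context satisfying properties (a1)--(a6), (Diam), (BD) and (Adj) (all defined in the context). Then there exist $0<c<C<\infty$ and $\varepsilon>0$ such that for all sufficiently small $\delta>0$, $$\frac{c}{M_\mu(\delta/\varepsilon)}\le\mathbb E_\mu(\tau_\delta)\le\frac{C}{M_\mu(\varepsilon\delta)}\log(1/\delta).$$ In particular, if $\dim_{\mathrm M}\mu<\infty$ then $$c\,\delta^{-\dim_{\mathrm M}\mu+\mathrm{Err}(\delta/\varepsilon)}\le\mathbb E_\mu(\tau_\delta)\le C\,\delta^{-\dim_{\mathrm M}\mu-\mathrm{Err}(\varepsilon\delta)}\log(1/\delta).$$
   Context: **Map.** $I\subset\mathbb R$ is a bounded interval, $\mathcal Z=\{Z_i\}_{i\in\mathcal I}$ a finite or countable collection of subintervals of $I$ with pairwise disjoint interiors, and $f:\bigcup_i Z_i\to I$ is continuous and strictly monotonic on each $Z_i$; $f_i:=f|_{Z_i}$ and $D=I\setminus\bigcup_i Z_i$. The repeller is $\Lambda=\{x\in I: f^k(x)\in\bigcup_i Z_i \text{ for all } k\ge 0\}$, and the dynamical system is $f:\Lambda\to\Lambda$ (for $U\subset I$, $f(U)$ means $f(\Lambda\cap U)$). $\mathcal Z^n$ is the set of $n$-cylinders: maximal intervals $Z\subset I$ such that for each $0\le k\le n-1$, $f^k(Z)\subset Z_{i_k}$ for some $Z_{i_k}\in\mathcal Z$; $\mathcal Z^0=\{I\}$. **Measures.** $m$ is a nonatomic Borel probability measure with $m(D)=0$ which is conformal for a potential $\phi:\Lambda\to\mathbb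 R$, i.e. $\frac{dm}{d(m\circ f)}=e^{\phi}$. Set $\phi|_D=-\infty$, $S_n\phi=\sum_{i=0}^{n-1}\phi\circ f^i$, $\mathcal L\psi(x)=\sum_{y\in f^{-1}x}\psi(y)e^{\phi(y)}$. (a1) There is $C_d>0$ with $|e^{S_n\phi(x)-S_n\phi(y)}-1|\le C_d|f^n(x)-f^n(y)|$ whenever $f^i(x),f^i(y)$ lie in the same element of $\mathcal Z$ for each $i=0,\dots,n-1$. (a2) There is $n_0\in\mathbb N$ with $\sup_\Lambda e^{S_{n_0}\phi}<\inf_{\Lambda\setminus D}\mathcal L^{n_0}1$. (a3) For each $x\in\Lambda$, $\delta>0$ such that $J=B(x,\delta)$ satisfies $J\cap D=\emptyset$, there is $N=N(J)$ with $\inf_{\Lambda\setminus D}\mathcal L^N\mathbf 1_{J\cap\Lambda}>0$. (a2) implies that one can fix $n_1\in\mathbb N$ with $(2n_1+5)(C_d+1)\sup_\Lambda e^{S_{n_1}\phi}<1$. (a4) There is $c_m>0$ with $\inf_{Z\in\mathcal Z^{n_1}}m(f^{n_1}(Z))\ge c_m$. Under (a1)--(a4) there is a unique $f$-invariant probability measure absolutely continuous with respect to $m$; $\mu$ denotes this measure; its density $g=d\mu/dm$ is of bounded variation and bounded away from $0$. **Symbolic coding.** $\Sigma\subset\mathcal I^{\mathbb N_0}$ is the set of sequences $(i_0,i_1,\dots)$ for which there is $x\in\Lambda$ with $f^n(x)\in Z_{i_n}$ for all $n\ge0$; $\Pi:\Sigma\to I$ sends the sequence to $x$, $\Pi(i_0,i_1,\dots)=\lim_{n}f_{i_0}^{-1}\circ\cdots\circ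 f_{i_{n-1}}^{-1}(I)$; $\Sigma_n$, $\Sigma^*$ are the sets of words of length $n$, resp. all finite words, of $\Sigma$; $[w]$ is the set of sequences in $\Sigma$ beginning with $w$; $\tilde\mu$ is the measure on $\Sigma$ with $\mu=\Pi_*\tilde\mu$. (a5) (quasi-Bernoulli) There is $C_*>1$ with $C_*^{-1}\tilde\mu([\mathbf i])\tilde\mu([\mathbf j])\le\tilde\mu([\mathbf i\mathbf j])\le C_*\tilde\mu([\mathbf i])\tilde\mu([\mathbf j])$ for all finite words $\mathbf i,\mathbf j\in\Sigma^*$ (with $\mathbf i\mathbf j\in\Sigma^*$). (a6) ($\psi$-mixing) $\left|\frac{\tilde\mu(\bigcup[x_0,\dots,x_{i-1},y_0,\dots,y_{j-1},z_0,\dots,z_{\ell-1}])}{\tilde\mu([x_0,\dots,x_{i-1}])\tilde\mu([z_0,\dots,z_{\ell-1}])}-1\right|\le\gamma(j)$, the union being over all words $y_0\dots y_{j-1}$ of length $j$ for which the concatenated word is in $\Sigma_{i+j+\ell}$, with $\gamma(j)\to0$ as $j\to\infty$. **Further properties.** (Diam) There are $C_m<\infty$, $s>0$ with $m(U)\le C_m\,\mathrm{diam}(U)^s$ for all intervals $U\subset I$. (BD) There is $C_{bd}>0$ such that $C_{bd}^{-1}\le |(f^n)'(x)|/|(f^n)'(y)|\le C_{bd}$ for all $n$ and all $x,y\in\Lambda$ such that $f^i(x),f^i(y)$ lie in the same element of $\mathcal Z$ for each $0\le i\le n-1$. (Adj) There is $C>0$ such that for all $n\ge 1$, $Z_{n-1}\in\mathcal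 Z^{n-1}$ and adjacent $Z,Z'\in\mathcal Z^n$ contained in $Z_{n-1}$, $\frac1C\le\frac{\mu(Z)}{\mu(Z')}\le C$. Adjacent means there is an interval $A\subset Z_{n-1}$ such that $Z,Z'$ are the only elements of $\mathcal Z^n$ intersecting $A$; it is also assumed that each $Z\in\mathcal Z^n$ in $Z_{n-1}$ has an adjacent $Z'\in\mathcal Z^n$ in $Z_{n-1}$. **Cover time and minimal ball measure.** For $\delta>0$ and $x\in\Lambda$, $\tau_\delta(x)=\inf\{n\ge1:\{x,f(x),\dots,f^n(x)\}\text{ is }\delta\text{-dense in }\Lambda\}$, where $Z'\subset Z$ is $\delta$-dense in $Z$ if every $x\in Z$ has some $x'\in Z'$ with $|x-x'|\le\delta$. $\mathbb E_\mu$ is expectation with respect to $\mu$. $M_\mu(\delta)=\min_{x\in\mathrm{supp}(\mu)}\mu(B(x,\delta))$, $B(x,\delta)$ an open ball. The Minkowski dimension of $\mu$ is $\dim_{\mathrm M}\mu=\lim_{\delta\to0}\frac{\log M_\mu(\delta)}{\log\delta}$ (the limit is understood to exist), and when it is finite, $\mathrm{Err}(\delta)=\left|\dim_{\mathrm M}\mu-\frac{\log M_\mu(\delta)}{\log\delta}\right|$. *)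

(* Defs.v *)
From HB Require Import structures.
From mathcomp Require Import all_boot all_order all_algebra.
From mathcomp Require Import all_classical all_reals all_analysis.

Set Implicit Arguments.
Unset Strict Implicit.
Unset Printing Implicit Defensive.

Import Order.TTheory GRing.Theory Num.Theory numFieldNormedType.Exports.
Local Open Scope classical_set_scope.
Local Open Scope ring_scope.

Section repeller.
Context {R : realType} {A : countType}.
Variables (I : set R) (Z : A -> set R) (f : R -> R).
Implicit Types (x y : R) (U V W : set R) (n k : nat) (u v w : seq A).

Definition branch_domain : set R := \bigcup_i Z i.

(* The map is the restriction of f : R -> R to branch_domain; no condition ever
   depends on the values of f elsewhere. *)
Record piecewise_monotone_map : Prop := PiecewiseMonotoneMap {
  pmm_interval : is_interval I ;
  pmm_bounded : bounded_set I ;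
  pmm_branch_interval : forall i, is_interval (Z i) ;
  pmm_branch_sub : forall i, Z i `<=` I ;
  pmm_branch_disjoint : trivIset setT (fun i => (Z i)°) ;
  pmm_maps_to : forall i, f @` Z i `<=` I ;
  pmm_continuous : forall i, {within Z i, continuous f} ;
  pmm_monotone : forall i,
    {in Z i &, {homo f : x y / x < y}} \/
    {in Z i &, {homo f : x y /~ x < y}} }.

Definition hole : set R := I `\` branch_domain.

Definition repeller : set R :=
  [set x | I x /\ forall k, branch_domain (iter k f x)].

(* f^n(U) with the convention f(U) = f(Lambda `&` U) *)
Definition image_iter n U : set R := iter n f @` (repeller `&` U).

Definition same_branches n x y : Prop :=
  forall i, (i < n)%N -> exists a, Z a (iter i f x) /\ Z a (iter i f y).

(* Since f^k(U) is required to lie in some branch for every k < n, the first n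
   iterates of f are defined on the whole of U, so the image here is the plain
   one.  Singletons count as intervals. *)
Definition in_branches n U : Prop :=
  [/\ is_interval U, U !=set0, U `<=` I &
      forall k, (k < n)%N -> exists a, iter k f @` U `<=` Z a].

Definition ncylinders n : set (set R) :=
  [set U | in_branches n U /\
           forall V, in_branches n V -> U `<=` V -> V = U].

Fixpoint word_interval w : set R :=
  if w is a :: w' then Z a `&` f @^-1` word_interval w' else I.

Section potential.
Variable phi : R -> R.

(* phi is a function on the repeller, extended by -oo elsewhere *)
Definition ext_potential x : \bar R :=
  if x \in repeller then (phi x)%:E else -oo%E.

Definition birkhoff_sum n x : R := \sum_(i < n) phi (iter i f x).

(* meant for nonnegative functions *)
Definition transfer (psi : R -> \bar R) : R -> \bar R := fun x =>
  (\esum_(y in [set y | branch_domain y /\ f y = x])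
     (psi y * expeR (ext_potential y)))%E.

Definition sup_exp_birkhoff n : \bar R :=
  ereal_sup [set (expR (birkhoff_sum n x))%:E | x in repeller].

Definition inf_transfer n (psi : R -> \bar R) : \bar R :=
  ereal_inf [set iter n transfer psi x | x in repeller `\` hole].

(* dm / d(m o f) = exp phi; m o f is a measure on each piece where f is
   injective *)
Definition conformal (m : set R -> \bar R) : Prop :=
  forall i (B : set (measurableTypeR R)), measurable B -> B `<=` Z i ->
    let mof := fun E : set (measurableTypeR R) => m (image_iter 1 (E `&` Z i)) in
    m B = (\int[mof]_(x in B) expeR (ext_potential x))%E.

Definition cond_a1 (Cd : R) : Prop :=
  0 < Cd /\
  forall n x y, repeller x -> repeller y -> same_branches n x y ->
    `|expR (birkhoff_sum n x - birkhoff_sum n y) - 1|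
      <= Cd * `|iter n f x - iter n f y|.

Definition cond_a2 : Prop :=
  exists n0, (sup_exp_birkhoff n0 < inf_transfer n0 (cst 1))%E.

Definition cond_a3 : Prop :=
  forall x (d : R), repeller x -> 0 < d -> ball x d `&` hole = set0 ->
    exists N,
      (0 < inf_transfer N (EFin \o \1_(ball x d `&` repeller)))%E.

Definition contraction_time (Cd : R) n1 : Prop :=
  (((2 * n1 + 5)%:R * (Cd + 1))%:E * sup_exp_birkhoff n1 < 1)%E.

Definition cond_a4 (m : set R -> \bar R) n1 : Prop :=
  exists2 cm : R, 0 < cm &
    (cm%:E <= ereal_inf [set m (image_iter n1 U) | U in ncylinders n1])%E.

End potential.

Definition f_invariant (mu : set (measurableTypeR R) -> \bar R) : Prop :=
  forall B, measurable B -> mu (repeller `&` f @^-1` B) = mu B.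

Definition bv_density_bounded_below
    (m mu : probability (measurableTypeR R) R) : Prop :=
  exists g : measurableTypeR R -> R,
    [/\ measurable_fun setT g,
        forall B, measurable B -> mu B = (\int[m]_(x in B) (g x)%:E)%E,
        exists V : R, forall a b, I a -> I b -> a <= b ->
          (total_variation a b g <= V%:E)%E &
        exists2 c : R, 0 < c & {ae m, forall x, c <= g x}].

Definition codes (s : nat -> A) x : Prop := forall n, Z (s n) (iter n f x).

Definition coding_sequence (s : nat -> A) : Prop :=
  exists x, repeller x /\ codes s x.

Definition Sigma : Type := {s : nat -> A | coding_sequence s}.

(* the point coded by s, which is unique for the systems considered: an interval of
   points with one itinerary would have positive conformal measure and expand forever *)
Definition Pi (s : Sigma) : R := get [set x | repeller x /\ codes (sval s) x].

(* [w], the sequences in Sigma beginning with w *)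
Definition cylinder w : set Sigma :=
  [set s | mkseq (sval s) (size w) = w].

Definition SigmaStar : set (seq A) := [set w | cylinder w !=set0].

(* Library measurable types are pointed: Sigma, which has no definable element, is
   pointed by a given sequence s0.  The sigma-algebra does not depend on s0. *)
Definition pointed_Sigma (s0 : Sigma) : Type := {classic Sigma}.
HB.instance Definition _ (s0 : Sigma) := Choice.on (pointed_Sigma s0).
HB.instance Definition _ (s0 : Sigma) := isPointed.Build (pointed_Sigma s0) s0.

Definition coding_space (s0 : Sigma) :=
  @g_sigma_algebraType (pointed_Sigma s0) (range cylinder).

Definition cond_a5 (mut : set Sigma -> \bar R) : Prop :=
  exists2 C : R, 1 < C &
    forall u v, SigmaStar u -> SigmaStar v -> SigmaStar (u ++ v) ->
      (C^-1%:E * mut (cylinder u) * mut (cylinder v) <= mut (cylinder (u ++ v))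
         <= C%:E * mut (cylinder u) * mut (cylinder v))%E.

(* the quotient is considered only when its denominator is nonzero *)
Definition cond_a6 (mut : set Sigma -> \bar R) : Prop :=
  exists2 gamma : nat -> R, gamma @ \oo --> (0 : R) &
    forall u v j, SigmaStar u -> SigmaStar v ->
      (0 < mut (cylinder u))%E -> (0 < mut (cylinder v))%E ->
      `| fine (mut (\bigcup_(w in [set w | size w = j /\ SigmaStar (u ++ w ++ v)])
                      cylinder (u ++ w ++ v)))
           / (fine (mut (cylinder u)) * fine (mut (cylinder v))) - 1 |
        <= gamma j.

Definition diam U : R := sup [set `|x - y| | x in U & y in U].

Definition cond_Diam (m : set R -> \bar R) : Prop :=
  exists C s : R, 0 < s /\
    forall U, is_interval U -> U `<=` I -> (m U <= (C * diam U `^ s)%:E)%E.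

(* derivative relative to U: one-sided at the endpoints of an interval *)
Definition is_deriv_within U (h : R -> R) x (d : R) : Prop :=
  (fun y => (h y - h x) / (y - x)) @ within U x^' --> d.

(* f^n may fail to be differentiable (or even continuous) across the boundary of
   the interval of a word of length n, so (f^n)' is taken within that interval;
   the existence of the derivative on the repeller is part of the condition. *)
Definition cond_BD : Prop :=
  exists2 C : R, 0 < C &
    forall w x y, repeller x -> repeller y ->
      word_interval w x -> word_interval w y ->
      exists dx dy : R,
        [/\ is_deriv_within (word_interval w) (iter (size w) f) x dx,
            is_deriv_within (word_interval w) (iter (size w) f) y dy &
            C^-1 <= `|dx| / `|dy| <= C].

Definition adjacent n (P U V : set R) : Prop :=
  U <> V /\
  exists B : set R,
    [/\ is_interval B, B `<=` P &
        forall W, ncylinders n W -> (W `&` B !=set0 <-> W = U \/ W = V)].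

Definition children n (P : set R) : set (set R) :=
  [set U | ncylinders n U /\ U `<=` P].

Definition cond_Adj (mu : set R -> \bar R) : Prop :=
  (exists2 C : R, 0 < C &
     forall n P U V, ncylinders n P -> children n.+1 P U -> children n.+1 P V ->
       adjacent n.+1 P U V ->
       C^-1 <= fine (mu U) / fine (mu V) <= C) /\
  (forall n P U, ncylinders n P -> children n.+1 P U ->
     exists V, children n.+1 P V /\ adjacent n.+1 P U V).

Definition delta_dense (d : R) (S T : set R) : Prop :=
  S `<=` T /\ forall x, T x -> exists2 y, S y & `|x - y| <= d.

Definition cover_time (d : R) x : \bar R :=
  ereal_inf [set n%:R%:E | n in
    [set n | (1 <= n)%N /\
             delta_dense d [set iter k f x | k in [set k | (k <= n)%N]] repeller]].

Definition expected_cover_time (mu : set (measurableTypeR R) -> \bar R) (d : R) :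
    \bar R :=
  (\int[mu]_(x in repeller) cover_time d x)%E.

End repeller.

Section minimal_ball.
Context {R : realType}.
Variable mu : set R -> \bar R.

(* every measurable set of positive measure splits *)
Definition nonatomic (m : set (measurableTypeR R) -> \bar R) : Prop :=
  forall B, measurable B -> (0 < m B)%E ->
    exists E, [/\ measurable E, E `<=` B & (0 < m E < m B)%E].

Definition supp : set R := [set x | forall r, 0 < r -> (0 < mu (ball x r))%E].

(* the infimum is attained when mu is a Borel probability measure with bounded
   support: supp is compact and x |-> mu (ball x d) is lower semicontinuous *)
Definition min_ball (d : R) : R := inf [set fine (mu (ball x d)) | x in supp].

Definition is_minkowski_dim (s : R) : Prop :=
  ln (min_ball d) / ln d @[d --> 0^'+] --> s.

Definition minkowski_err (s d : R) : R := `|s - ln (min_ball d) / ln d|.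

End minimal_ball.

(* Main.v *)
Require Import Defs.
From HB Require Import structures.
From mathcomp Require Import all_boot all_order all_algebra.
From mathcomp Require Import all_classical all_reals all_analysis.
From mathcomp Require Import measurable_realfun.
From mathcomp Require Import ring lra zify.

Set Implicit Arguments.
Unset Strict Implicit.
Unset Printing Implicit Defensive.

Import Order.TTheory GRing.Theory Num.Theory numFieldNormedType.Exports.
Local Open Scope classical_set_scope.
Local Open Scope ring_scope.

(** Why the theorem is true.

    Lower bound.  Until an orbit comes within d of every point of the repeller
    it must have visited every ball of radius d centred there, in particular
    one inside a ball B of nearly minimal measure.  By invariance an orbit
    meets B before time n with probability at most n * mu B
    ([mu_misses]), so the expected cover time is at least of order 1 / mu B
    ([expected_cover_time_ge]).

    Upper bound.  Cover the repeller by O(1 / d) balls of radius d / 2 centred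
    at points x of the repeller ([finite_net]) and wait until all of them have
    been visited.  The point is to show that the probability of missing one
    ball for r * L steps decays like q ^ r, where q < 1 is a constant and L is
    only of order 1 / M, with M the minimal measure of a ball of radius d / 4;
    a union bound over the balls then costs the factor ln (1 / d)
    ([geometric_tail_majorant], [expected_cover_time_upper]).

    The tail estimate [pr_avoids_le] is symbolic.  A ball cannot be replaced by
    one cylinder contained in it, whose measure could be far too small when
    there are infinitely many branches.  Instead, follow the itinerary of a
    point within d / 4 of x until the interval of its prefix is contained in the
    ball of radius d / 2, and take all the words so obtained as targets.  Before
    that time the intervals stick out of the ball, so they all contain the same
    half of the annulus of radii d / 4 and d / 2.
    Two words of equal length whose intervals share two points coincide
    ([word_eq]), so the words attached to one half have
    all their proper prefixes along a single branch of the tree of words: they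
    form a chain ([chain_entering]).  The targets on the two sides capture all
    itineraries of points of the ball of radius d / 4 ([entering_cover]), so one
    of them has measure e at least M / 2.

    For a chain the hits at two times at distance r * l0 are nearly
    independent: the quasi-Bernoulli property bounds their joint probability by
    C * (e + q0 ^ r) * e ([pr_two_hits]), because either the first word has
    ended by then, or it starts with the unique prefix of length r * l0, whose
    measure is exponentially small ([pr_starts_decay]).  Looking only at sparse
    times, Bonferroni's inequality gives a hit with probability bounded below
    in a block of length O(1 / e) ([pr_hits]), and the lower half of
    psi-mixing, with one fixed gap j0, makes successive blocks independent
    enough to iterate ([pr_avoid]).

    Two facts connect the symbols with the interval.  By (a3) no nondegenerate
    interval stays inside single branches forever ([no_homterval]): a ball
    inside it would have to cover the whole repeller under some f^N, which is
    injective there.  Hence itineraries determine points and the coding map is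
    measurable ([measurable_Pi]).  By (Adj) every cylinder has positive
    measure, hence every point of the repeller lies in the support of mu
    ([repeller_sub_supp]); without this the cover time could be infinite.

    The estimates with the Minkowski dimension s rewrite M(r) as a power of
    r with exponent s up to the error term; the factors eps ^ s and
    eps ^ (- s - 1) that appear are absorbed in the constants, since s is
    unique. *)

(** * Probabilities as real numbers *)

Section real_probability.
Context d (T : measurableType d) (R : realType) (P : probability T R).
Implicit Types (E F G : set T).

Definition pr E : R := fine (P E).

Lemma prE E : measurable E -> P E = (pr E)%:E.
Proof. by move=> mE; rewrite fineK// fin_num_measure. Qed.

Lemma pr_ge0 E : 0 <= pr E.
Proof. exact/fine_ge0/measure_ge0. Qed.

Lemma le_pr E F : measurable E -> measurable F -> E `<=` F -> pr E <= pr F.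
Proof.
by move=> mE mF EF; rewrite -lee_fin -!prE//; apply: le_measure; rewrite ?inE.
Qed.

Lemma pr_set0 : pr set0 = 0.
Proof. by rewrite /pr measure0. Qed.

Lemma pr_setT : pr setT = 1.
Proof. by rewrite /pr probability_setT. Qed.

Lemma pr_le1 E : measurable E -> pr E <= 1.
Proof. by move=> mE; rewrite -pr_setT le_pr. Qed.

Lemma prU E F : measurable E -> measurable F -> [disjoint E & F] ->
  pr (E `|` F) = pr E + pr F.
Proof.
move=> mE mF /disj_set2P EF; apply: EFin_inj.
by rewrite EFinD -!prE ?measureU//; exact: measurableU.
Qed.

Lemma pr_split E F : measurable E -> measurable F ->
  pr E = pr (E `&` F) + pr (E `\` F).
Proof.
move=> mE mF; rewrite -prU ?setUIDK//.
- exact: measurableI.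
- exact: measurableD.
- by apply/disj_set2P; rewrite setDE setIACA setICr setI0.
Qed.

Lemma prU_le E F : measurable E -> measurable F ->
  pr (E `|` F) <= pr E + pr F.
Proof.
move=> mE mF; rewrite -lee_fin EFinD -!prE//; last exact: measurableU.
exact: measureU2.
Qed.

(** By countable additivity the mass of an event is the sum of the masses of its
    intersections with the fibres of a discrete random variable, so two
    measures of two different events can be compared fibre by fibre.  This is
    how inequalities between cylinders become inequalities between events
    depending on finitely many symbols. *)
Lemma pr_fibers (W : countType) (X Y : T -> W) E F (a b : R) :
  measurable E -> measurable F ->
  (forall w, measurable (X @^-1` [set w])) ->
  (forall w, measurable (Y @^-1` [set w])) ->
  0 <= a -> 0 <= b ->
  (forall w, a * pr (E `&` X @^-1` [set w]) <= b * pr (F `&` Y @^-1` [set w])) ->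
  a * pr E <= b * pr F.
Proof.
move=> mE mF mX mY a0 b0 ab.
have fibre (Z : T -> W) n : (forall w, measurable (Z @^-1` [set w])) ->
    measurable ((pickle \o Z) @^-1` [set n]).
  move=> mZ; case Dn : (pickle_inv n) => [w|].
    suff -> : (pickle \o Z) @^-1` [set n] = Z @^-1` [set w] by [].
    apply/seteqP; split => t /=.
      by move=> nE; move: Dn; rewrite -nE pickleK_inv => -[].
    by move=> ->; have := @pickle_invK W n; rewrite Dn /=.
  suff -> : (pickle \o Z) @^-1` [set n] = set0 by [].
  apply/seteqP; split => t //= nE.
  by move: Dn; rewrite -nE pickleK_inv.
have sumE (Z : T -> W) G : measurable G ->
    (forall w, measurable (Z @^-1` [set w])) ->
    (P G = \sum_(n <oo) P (G `&` (pickle \o Z) @^-1` [set n]))%E.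
  move=> mG mZ.
  rewrite [in LHS](_ : G = \bigcup_n (G `&` (pickle \o Z) @^-1` [set n])); last first.
    apply/seteqP; split => [t Gt|t [n _ []]//].
    by exists (pickle (Z t)).
  rewrite measure_bigcup.
  - by apply: eq_eseriesl => n; rewrite in_setT.
  - by move=> n _; apply: measurableI => //; exact: fibre.
  - apply/trivIsetP => i j _ _ /eqP ij; apply/seteqP; split => // t.
    by move=> [[_ /= Ei] [_ /= Ej]]; apply: ij; rewrite -Ei.
rewrite -lee_fin !EFinM -!prE// (sumE X E)// (sumE Y F)//.
rewrite -!nneseriesZl//.
apply: lee_nneseries => [n _ _|n _]; first by rewrite mule_ge0 ?lee_fin.
rewrite !prE -?EFinM ?lee_fin; last 2 first.
- by apply: measurableI => //; exact: fibre.
- by apply: measurableI => //; exact: fibre.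
case Dn : (pickle_inv n) => [w|].
  have H (Z : T -> W) : (pickle \o Z) @^-1` [set n] = Z @^-1` [set w].
    apply/seteqP; split => t /=.
      by move=> nE; move: Dn; rewrite -nE pickleK_inv => -[].
    by move=> ->; have := @pickle_invK W n; rewrite Dn /=.
  by rewrite !H.
have H (Z : T -> W) : (pickle \o Z) @^-1` [set n] = set0.
  apply/seteqP; split => t //= nE.
  by move: Dn; rewrite -nE pickleK_inv.
by rewrite !H !setI0 pr_set0 !mulr0.
Qed.

End real_probability.

(** * Events depending on finitely many symbols *)

Section sequence_events.
Context {A : eqType}.
Implicit Types (s : nat -> A) (F G : set (nat -> A)) (n p : nat) (w : seq A).

Definition shift p s : nat -> A := fun i => s (p + i)%N.

Definition determined n G : Prop :=
  forall s s', (forall i, (i < n)%N -> s i = s' i) -> G s -> G s'.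

Definition starts w : set (nat -> A) := [set s | mkseq s (size w) = w].

Lemma eq_mkseqP n s s' :
  mkseq s n = mkseq s' n <-> forall i, (i < n)%N -> s i = s' i.
Proof.
split=> [E i ni|E].
  by rewrite -(nth_mkseq (s 0%N) s ni) E nth_mkseq.
by apply/eq_in_map => i; rewrite mem_iota => /andP[_]; exact: E.
Qed.

Lemma determined_starts w : determined (size w) (starts w).
Proof.
move=> s s' ss' sw; rewrite /starts /= -[RHS]sw.
by symmetry; apply/eq_mkseqP.
Qed.

Lemma determined_le n n' G : (n <= n')%N -> determined n G -> determined n' G.
Proof. by move=> nn' dG s s' ss'; apply: dG => i /leq_trans; move/(_ _ nn')/ss'. Qed.

Lemma determinedC n G : determined n G -> determined n (~` G).
Proof. by move=> dG s s' ss' nG Gs'; apply: nG; apply: dG Gs' => i /ss'. Qed.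

Lemma determinedI n F G : determined n F -> determined n G ->
  determined n (F `&` G).
Proof. by move=> dF dG s s' ss' [/(dF _ _ ss') ? /(dG _ _ ss')]. Qed.

Lemma determinedU n F G : determined n F -> determined n G ->
  determined n (F `|` G).
Proof. by move=> dF dG s s' ss' [/(dF _ _ ss')|/(dG _ _ ss')]; [left|right]. Qed.

Lemma determined_bigcup I n (F : I -> set (nat -> A)) (D : set I) :
  (forall i, D i -> determined n (F i)) -> determined n (\bigcup_(i in D) F i).
Proof. by move=> dF s s' ss' [i Di /(dF i Di _ _ ss')]; exists i. Qed.

Lemma determined_shift p n G : determined n G ->
  determined (p + n) (shift p @^-1` G).
Proof.
by move=> dG s s' ss'; apply: dG => i ni; apply: ss'; rewrite ltn_add2l.
Qed.

Lemma shift_shift p q s : shift q (shift p s) = shift (p + q) s.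
Proof. by apply/funext => i; rewrite /shift addnA. Qed.

Lemma mkseq_add s n p : mkseq s (n + p) = mkseq s n ++ mkseq (shift n s) p.
Proof.
rewrite /mkseq iotaD map_cat; congr cat.
by rewrite -{1}[n in (0 + n)%N]addn0 add0n iotaDl -map_comp.
Qed.

Lemma starts_cat u v :
  starts (u ++ v) = starts u `&` shift (size u) @^-1` starts v.
Proof.
apply/seteqP; split => s; rewrite /starts /= size_cat mkseq_add.
  by move=> /eqP; rewrite eqseq_cat ?size_mkseq// => /andP[/eqP ? /eqP].
by move=> [-> ->].
Qed.

End sequence_events.

Section coded_process.
Context d (T : measurableType d) (R : realType) (P : probability T R).
Context (A : countType) (X : T -> nat -> A).
Hypothesis mX : forall k a, measurable [set t | X t k = a].
Implicit Types (F G : set (nat -> A)) (n p : nat) (u v w : seq A).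
Local Notation pr := (pr P).

Definition window p n t : seq A := mkseq (shift p (X t)) n.

(** Events are written as a set of sequences tested on the itinerary read from
    time p, which avoids a shift acting on the sample space. *)
Definition ev p G : set T := [set t | G (shift p (X t))].

Lemma measurable_window p n w : measurable (window p n @^-1` [set w]).
Proof.
elim: n w => [|n IH] w.
  case: w => [|a w].
    rewrite (_ : _ @^-1` _ = setT); first exact: measurableT.
    by apply/seteqP; split.
  rewrite (_ : _ @^-1` _ = set0); first exact: measurable0.
  by apply/seteqP; split.
case/lastP: w => [|w a].
  rewrite (_ : _ @^-1` _ = set0); first exact: measurable0.
  by apply/seteqP; split => t //= /(congr1 size).
rewrite (_ : _ @^-1` _ =
    window p n @^-1` [set w] `&` [set t | X t (p + n)%N = a]).
  exact: measurableI.
apply/seteqP; split => t /=; rewrite /window mkseqS.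
  by move=> /rcons_inj[].
by move=> [-> <-].
Qed.

Lemma measurable_ev p n G : determined n G -> measurable (ev p G).
Proof.
move=> dG; pose D w := exists2 s, G s & mkseq s n = w.
rewrite (_ : ev p G = \bigcup_(w : seq A)
    (if `[< D w >] then window p n @^-1` [set w] else set0)).
  apply: countable_bigcupT_measurable => [|w]; first exact: countableP.
  by case: ifP => _; [exact: measurable_window | exact: measurable0].
apply/seteqP; split => t /=.
  move=> Gt; exists (window p n t) => //.
  by case: asboolP => // -[]; exists (shift p (X t)).
move=> [w _]; case: asboolP => // -[s Gs sw] /= E.
by apply: dG Gs; apply/eq_mkseqP; rewrite sw -E.
Qed.

Lemma ev_window p n G w : determined n G ->
  ev p G `&` window p n @^-1` [set w] =
  if `[< exists2 s, G s & mkseq s n = w >] then ev p (starts w) else set0.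
Proof.
move=> dG; case: asboolP => [[s Gs sw]|no].
  have nw : size w = n by rewrite -sw size_mkseq.
  apply/seteqP; split => t; rewrite /ev /starts /window /= nw; first by case.
  by move=> tw; split => //; apply: dG Gs; apply/eq_mkseqP; rewrite sw.
apply/seteqP; split => t // [Gt /= tw].
by apply: no; exists (shift p (X t)).
Qed.

Lemma ev_shift p q G : ev p (shift q @^-1` G) = ev (p + q) G.
Proof.
by apply/seteqP; split => t; rewrite /ev /= shift_shift.
Qed.

Lemma evI p F G : ev p (F `&` G) = ev p F `&` ev p G.
Proof. by []. Qed.

Section mixing.
Variables (C : R) (j0 : nat).
Hypothesis C_ge0 : 0 <= C.
Hypothesis pr_cat : forall u v,
  pr (ev 0 (starts (u ++ v))) <= C * pr (ev 0 (starts u)) * pr (ev 0 (starts v)).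
Hypothesis pr_gap : forall u v,
  2^-1 * pr (ev 0 (starts u)) * pr (ev 0 (starts v)) <=
  pr (ev 0 (starts u) `&` ev (size u + j0) (starts v)).

(** The quasi-Bernoulli upper bound passes from two words to two events by
    summing over the words that realise them. *)
Lemma pr_upper i l F G : determined i F -> determined l G ->
  pr (ev 0 F `&` ev i G) <= C * pr (ev 0 F) * pr (ev 0 G).
Proof.
move=> dF dG.
have mF := measurable_ev 0 dF; have mG p := measurable_ev p dG.
have mst p w := measurable_ev p (@determined_starts _ w).
have step u : size u = i ->
    pr (ev 0 (starts u) `&` ev i G) <= C * pr (ev 0 (starts u)) * pr (ev 0 G).
  move=> ui; rewrite -[leLHS]mul1r.
  apply: (@pr_fibers _ _ _ _ _ (window i l) (window 0 l)) => //.
  - exact: measurableI.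
  - exact: measurable_window.
  - exact: measurable_window.
  - by rewrite mulr_ge0// pr_ge0.
  move=> w; rewrite -setIA !ev_window// mul1r.
  case: asboolP => _; last by rewrite setI0 pr_set0 mulr0.
  by rewrite (_ : _ `&` _ = ev 0 (starts (u ++ w))) ?pr_cat// starts_cat evI ev_shift ui.
rewrite mulrAC -[leLHS]mul1r.
apply: (@pr_fibers _ _ _ _ _ (window 0 i) (window 0 i)) => //.
- exact: measurableI.
- exact: measurable_window.
- exact: measurable_window.
- by rewrite mulr_ge0// pr_ge0.
move=> w; rewrite setIAC !ev_window// mul1r.
case: asboolP => [[s _ sw]|_]; last by rewrite set0I pr_set0 mulr0.
by rewrite mulrAC step// -sw size_mkseq.
Qed.

(** The same summation for the mixing lower bound; the j0 symbols between the two
    events are arbitrary. *)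
Lemma pr_lower i l F G : determined i F -> determined l G ->
  2^-1 * pr (ev 0 F) * pr (ev 0 G) <= pr (ev 0 F `&` ev (i + j0) G).
Proof.
move=> dF dG.
have mF := measurable_ev 0 dF; have mG p := measurable_ev p dG.
have mst p w := measurable_ev p (@determined_starts _ w).
have step u : size u = i ->
    2^-1 * pr (ev 0 (starts u)) * pr (ev 0 G) <=
    pr (ev 0 (starts u) `&` ev (i + j0) G).
  move=> ui; rewrite -[leRHS]mul1r.
  apply: (@pr_fibers _ _ _ _ _ (window 0 l) (window (i + j0) l)) => //.
  - exact: measurableI.
  - exact: measurable_window.
  - exact: measurable_window.
  - by rewrite mulr_ge0// pr_ge0.
  move=> w; rewrite -setIA !ev_window// mul1r.
  case: asboolP => _; last by rewrite setI0 pr_set0 mulr0.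
  by rewrite -ui.
rewrite mulrAC -[leRHS]mul1r.
apply: (@pr_fibers _ _ _ _ _ (window 0 i) (window 0 i)) => //.
- exact: measurableI.
- exact: measurable_window.
- exact: measurable_window.
- by rewrite mulr_ge0// pr_ge0.
move=> w; rewrite setIAC !ev_window// mul1r.
case: asboolP => [[s _ sw]|_]; last by rewrite set0I pr_set0 mulr0.
by rewrite mulrAC step// -sw size_mkseq.
Qed.

End mixing.
End coded_process.

(** * Elementary estimates on powers *)

Section geometric.
Context {R : realFieldType}.
Implicit Types (q x e : R) (n : nat).

(** Bernoulli's inequality in a form that is also meaningful at q = 0. *)
Lemma expr_le_harmonic q n : 0 <= q -> q <= 1 -> q ^+ n * (1 + n%:R * (1 - q)) <= 1.
Proof.
move=> q0 q1; elim: n => [|n IH]; first by rewrite expr0 mul0r addr0 mulr1.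
apply: le_trans IH; rewrite -subr_ge0 exprS -natr1.
rewrite [X in 0 <= X](_ : _ = q ^+ n * ((n%:R + 1) * (1 - q) ^+ 2)); last by ring.
apply: mulr_ge0; first exact: exprn_ge0.
by apply: mulr_ge0; [rewrite addr_ge0|exact: sqr_ge0].
Qed.

Lemma sum_expr_le x n : 0 <= x -> x < 1 -> \sum_(i < n) x ^+ (n - i) <= x / (1 - x).
Proof.
move=> x0 x1; have x1' : 1 - x != 0 by rewrite subr_eq0 gt_eqF.
elim: n => [|n IH]; first by rewrite big_ord0 divr_ge0// subr_ge0 ltW.
rewrite big_ord_recr /= subSnn expr1.
under eq_bigr => i _ do rewrite subSn 1?ltnW// exprS.
rewrite -mulr_sumr.
have -> : x / (1 - x) = x * (x / (1 - x)) + x by field.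
by rewrite lerD2r ler_wpM2l.
Qed.

End geometric.

(** Powers of q drop below e / 2 after O(1 / e) steps; a logarithmic number would
    do, but O(1 / e) is what a block of symbols is allowed to cost. *)
Lemma expr_reaches (R : realType) (q : R) : 0 <= q -> q < 1 ->
  exists2 J : R, 0 < J &
  forall e, 0 < e -> e <= 1 -> exists2 j : nat, q ^+ j <= e / 2 & j%:R <= J / e.
Proof.
move=> q0 q1; have p0 : 0 < 1 - q by rewrite subr_gt0.
exists (2 / (1 - q) + 1); first by rewrite addr_gt0 ?divr_gt0.
move=> e e0 e1; pose y := 2 / e / (1 - q).
have y0 : 0 <= y by rewrite !divr_ge0// ltW.
exists (Num.truncn y).+1; last first.
  rewrite -natr1 mulrDl mul1r lerD ?invf_ge1//.
  by rewrite mulrAC truncn_le.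
have yj : y < (Num.truncn y).+1%:R by exact: truncnS_gt.
have := expr_le_harmonic (Num.truncn y).+1 q0 (ltW q1).
set z := q ^+ _; have z0 : 0 <= z by rewrite exprn_ge0.
have : 2 / e <= 1 + (Num.truncn y).+1%:R * (1 - q).
  by rewrite ler_wpDl// -ler_pdivrMr// ltW.
move: (_ + _) => b eb zb.
have : z * (2 / e) <= 1 by apply: le_trans zb; rewrite ler_wpM2l.
by rewrite mulrA ler_pdivrMr// mul1r ler_pdivlMr.
Qed.

(** * Chains of words and repeated avoidance *)

Section chains.
Context {A : eqType}.
Implicit Types (W : set (seq A)) (n : nat) (w : seq A).

(** The proper prefixes of the words of a chain lie on one branch of the tree of
    words. *)
Definition chain W : Prop := forall w w' n, W w -> W w' ->
  (n < size w)%N -> (n < size w')%N -> take n w = take n w'.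

Definition starts_in W : set (nat -> A) := \bigcup_(w in W) starts w.

Definition bounded_words n W : set (seq A) := [set w | W w /\ (size w <= n)%N].

Lemma determined_starts_in n W : (forall w, W w -> (size w <= n)%N) ->
  determined n (starts_in W).
Proof.
move=> Wn; apply: determined_bigcup => w /Wn wn.
exact: determined_le wn (@determined_starts _ w).
Qed.

Lemma take_drop_mkseq (s : nat -> A) m n k : (m + k <= n)%N ->
  take k (drop m (mkseq s n)) = mkseq (shift m s) k.
Proof.
move=> mkn; rewrite -(subnKC mkn) !mkseq_add -catA.
by rewrite drop_size_cat ?size_mkseq// take_size_cat ?size_mkseq.
Qed.

Lemma determined_avoid l j0 (H : nat -> set (nat -> A)) r :
  (forall q, determined l (H q)) ->
  determined (r * (l + j0)) [set s | forall q, (q < r)%N ->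
                              ~ H q (shift (q * (l + j0) + j0) s)].
Proof.
move=> dH s s' ss' Ns q qr Hs'; apply: (Ns q qr); apply: dH Hs' => i il.
rewrite /shift ss'//; apply: leq_trans (leq_mul qr (leqnn (l + j0)%N)).
by rewrite mulSn; move: (q * _)%N il => b; lia.
Qed.

Lemma starts_take n w : starts w `<=` starts (take n w).
Proof.
by move=> s; rewrite -{1}(cat_take_drop n w) starts_cat => -[].
Qed.

End chains.

Section hitting.
Context d (T : measurableType d) (R : realType) (P : probability T R).
Context (A : countType) (X : T -> nat -> A).
Hypothesis mX : forall k a, measurable [set t | X t k = a].
Variable j0 : nat.
Local Notation pr := (pr P).
Local Notation ev := (ev X).
Hypothesis pr_gap : forall u v,
  2^-1 * pr (ev 0 (starts u)) * pr (ev 0 (starts v)) <=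
  pr (ev 0 (starts u) `&` ev (size u + j0) (starts v)).

Let mev p n G : determined n G -> measurable (ev p G) := @measurable_ev _ _ _ _ mX p n G.

(** Each of r blocks of l symbols, preceded by a gap of j0 symbols, has
    conditional probability at least h / 2 of realising its event, whatever
    happened before the gap. *)
Lemma pr_avoid l (H : nat -> set (nat -> A)) (h : R) :
  (forall q, determined l (H q)) ->
  forall r, (forall q, (q < r)%N -> h <= pr (ev 0 (H q))) -> pr (ev 0 [set s | forall q, (q < r)%N ->
                              ~ H q (shift (q * (l + j0) + j0) s)])
    <= (1 - h / 2) ^+ r.
Proof.
move=> dH; pose N r := [set s | forall q, (q < r)%N ->
                              ~ H q (shift (q * (l + j0) + j0) s)].
have dN r : determined (r * (l + j0)) (N r) by exact: determined_avoid.
elim=> [|r IH] hH; rewrite -/(N _); first by rewrite expr0 pr_le1//; exact: mev (dN 0%N).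
have h1 : h <= 1 by rewrite (le_trans (hH 0%N _))// pr_le1//; exact: mev (dH _).
have {}IH := IH (fun q qr => hH q (leqW qr)); have {}hH := hH r (leqnn _).
have mN q := mev 0 (dN q).
have mB := mev (r * (l + j0) + j0) (dH r).
have -> : ev 0 (N r.+1) = ev 0 (N r) `\` ev (r * (l + j0) + j0) (H r).
  apply/seteqP; split => t.
    by move=> Nt; split => [q qr|]; [apply: Nt; exact: leqW | exact: (Nt r)].
  move=> [Nt Ht] q; rewrite ltnS leq_eqVlt => /orP[/eqP ->//|]; exact: Nt.
have := pr_split P (mN r) mB.
have := pr_lower mX pr_gap (dN r) (dH r).
have : 0 <= 2^-1 * pr (ev 0 (N r)) * (pr (ev 0 (H r)) - h).
  by rewrite !mulr_ge0 ?pr_ge0// subr_ge0.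
have : 0 <= (1 - h / 2) * ((1 - h / 2) ^+ r - pr (ev 0 (N r))).
  by rewrite mulr_ge0 ?subr_ge0// ler_pdivrMr// mul1r (le_trans h1)// ler1n.
rewrite exprS -/(N r); move: (_ ^+ r) (pr _) (pr _) (pr _) (pr _) => y a b c f; lra.
Qed.


Section decay.
Variables (k : nat) (eta : R).
Hypothesis eta_gt0 : 0 < eta.
Hypothesis pr_word : forall w, size w = k -> pr (ev 0 (starts w)) <= 1 - eta.

(** Reading w forces every block of k symbols to agree with w; the opposite event
    has probability at least eta in each block. *)
Lemma pr_starts_decay w r : (r * (k + j0) <= size w)%N ->
  pr (ev 0 (starts w)) <= (1 - eta / 2) ^+ r.
Proof.
move=> rw; pose H q := ~` starts (take k (drop (q * (k + j0) + j0) w)).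
have sz q : (size (take k (drop (q * (k + j0) + j0) w)) <= k)%N.
  by rewrite size_take; case: ltnP.
have dH q : determined k (H q).
  by apply: determinedC; apply: determined_le (sz q) (@determined_starts _ _).
have bound q : (q < r)%N -> (q * (k + j0) + j0 + k <= size w)%N.
  move=> qr; apply: leq_trans rw; apply: leq_trans (leq_mul qr (leqnn _)).
  by rewrite mulSn; move: (q * _)%N => b; lia.
have sz_eq q : (q < r)%N -> size (take k (drop (q * (k + j0) + j0) w)) = k.
  by move=> /bound qr; apply: size_takel; rewrite size_drop; lia.
have hH q : (q < r)%N -> eta <= pr (ev 0 (H q)).
  move=> qr; rewrite /H; set v := take _ _.
  have mS := mev 0 (@determined_starts _ v).
  have := pr_split P measurableT mS; rewrite pr_setT setTI setTD.
  have := pr_word (sz_eq q qr); rewrite -/v.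
  have -> : ev 0 (~` starts v) = ~` ev 0 (starts v) by [].
  by move: (pr _) (pr _) => x y; lra.
apply: le_trans (pr_avoid dH hH); apply: le_pr.
- exact: mev (@determined_starts _ w).
- exact: (mev 0 (determined_avoid dH)).
move=> t tw q qr; apply; rewrite /starts /= sz_eq// -[in RHS]tw.
by rewrite take_drop_mkseq// bound.
Qed.

End decay.

End hitting.

(** * Hitting times of chains *)

Lemma block_position q r g i n k j L : (q < r)%N -> (i < n)%N -> (0 < g)%N ->
  (g * n + k + j <= L)%N -> (q * (g * n + k + j) + j + g * i < r * L)%N.
Proof.
move=> qr ni g0 gL; apply: leq_trans (leq_mul qr gL).
have : (g * i < g * n)%N by rewrite ltn_mul2l g0.
by rewrite mulSn; move: (g * i)%N (g * n)%N (q * _)%N => a b c; clear; lia.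
Qed.

Section hitting_time.
Context d (T : measurableType d) (R : realType) (P : probability T R).
Context (A : countType) (X : T -> nat -> A).
Hypothesis mX : forall k a, measurable [set t | X t k = a].
Variables (C : R) (j0 : nat).
Hypothesis C_ge1 : 1 <= C.
Local Notation pr := (pr P).
Local Notation ev := (ev X).
Hypothesis pr_cat : forall u v,
  pr (ev 0 (starts (u ++ v))) <= C * pr (ev 0 (starts u)) * pr (ev 0 (starts v)).
Hypothesis pr_gap : forall u v,
  2^-1 * pr (ev 0 (starts u)) * pr (ev 0 (starts v)) <=
  pr (ev 0 (starts u) `&` ev (size u + j0) (starts v)).
Variables (q0 : R) (l0 : nat).
Hypotheses (q0_ge0 : 0 <= q0) (q0_lt1 : q0 < 1) (l0_gt0 : (0 < l0)%N).
Hypothesis pr_decay : forall w r, (r * l0 <= size w)%N ->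
  pr (ev 0 (starts w)) <= q0 ^+ r.
Implicit Types (W : set (seq A)).

Let mev p n G : determined n G -> measurable (ev p G) := @measurable_ev _ _ _ _ mX p n G.

Let C_ge0 : 0 <= C. Proof. exact: le_trans C_ge1. Qed.

(** All the words of a chain that are longer than n start with the same prefix of
    length n, so together they have exponentially small measure. *)
Lemma long_words W r : chain W -> exists V : set (nat -> A),
  [/\ determined (r * l0) V, pr (ev 0 V) <= q0 ^+ r &
      starts_in W `<=` starts_in (bounded_words (r * l0) W) `|` V].
Proof.
move=> cW; set n := (r * l0)%N.
have [[w0 [Ww0 nw0]]|no] := pselect (exists w0, W w0 /\ (n < size w0)%N).
  have sz : size (take n w0) = n by rewrite size_takel// ltnW.
  exists (starts (take n w0)); split.
  - by rewrite -{1}sz; exact: determined_starts.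
  - by apply: pr_decay; rewrite sz.
  move=> s [w Ww sw]; have [wn|nw] := leqP (size w) n.
    by left; exists w.
  by right; rewrite (cW w0 w n)//; exact: starts_take.
exists set0; split => //.
- by rewrite [ev 0 _](_ : _ = set0)// pr_set0 exprn_ge0.
move=> s [w Ww sw]; left; exists w => //; split => //.
by rewrite leqNgt; apply/negP => nw; apply: no; exists w.
Qed.

Lemma pr_shift_upper p n G : determined n G -> pr (ev p G) <= C * pr (ev 0 G).
Proof.
move=> dG; have dT : determined p (setT : set (nat -> A)) by [].
have := pr_upper mX C_ge0 pr_cat dT dG.
by rewrite (_ : ev 0 setT = setT)// setTI pr_setT mulr1.
Qed.

Lemma pr_shift_lower p n G : determined n G -> p = 0%N \/ (j0 <= p)%N ->
  pr (ev 0 G) / 2 <= pr (ev p G).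
Proof.
move=> dG [->|j0p].
  by rewrite ler_pdivrMr// ler_peMr ?pr_ge0// ler1n.
have dT : determined (p - j0) (setT : set (nat -> A)) by [].
have := pr_lower mX pr_gap dT dG.
by rewrite (_ : ev 0 setT = setT)// setTI pr_setT mulr1 subnK// mulrC.
Qed.

(** When the second word begins, the first one has either ended, in which case
    the two occurrences are independent up to the factor C, or reduces to the
    common prefix V of the long words of the chain. *)
Lemma pr_two_hits W n r (E := starts_in W) : chain W -> (forall w, W w -> (size w <= n)%N) ->
  pr (ev 0 (E `&` shift (r * l0) @^-1` E))
    <= C * (pr (ev 0 E) + q0 ^+ r) * pr (ev 0 E).
Proof.
move=> cW Wn; have dE : determined n E by apply: determined_starts_in.
have [V [dV pV EV]] := long_words r cW.
pose G := starts_in (bounded_words (r * l0) W).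
have dG : determined (r * l0) G by apply: determined_starts_in => w [].
have GE : G `<=` E by move=> s [w [Ww _] sw]; exists w.
have dGV := determinedU dG dV.
apply: le_trans (_ : pr (ev 0 (G `|` V) `&` ev (r * l0) E) <= _).
  apply: le_pr.
  - apply: (@mev _ (r * l0 + n)); apply: determinedI; last exact: determined_shift.
    by apply: determined_le dE; exact: leq_addl.
  - by apply: measurableI; [exact: mev dGV | exact: mev dE].
  by move=> t [/EV ? ?].
apply: le_trans (pr_upper mX C_ge0 pr_cat dGV dE) _.
rewrite ler_wpM2r ?pr_ge0// ler_wpM2l//.
have mG := mev 0 dG; have mV := mev 0 dV.
apply: le_trans (prU_le P mG mV) _; rewrite lerD//.
by apply: le_pr => //; [exact: mev dE | move=> t /GE].
Qed.

Definition hits g n (E : set (nat -> A)) : set (nat -> A) :=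
  [set s | exists2 i, (i < n)%N & E (shift (g * i) s)].

Lemma determined_hits g n k E : determined k E -> determined (g * n + k) (hits g n E).
Proof.
move=> dE s s' ss' [i ni Es]; exists i => //; apply: dE Es => j jk.
apply: ss'; rewrite (leq_ltn_trans (_ : _ <= g * n + j)%N) ?ltn_add2l//.
by rewrite leq_add2r leq_mul2l (ltnW ni) orbT.
Qed.

(** Second moment method, by Bonferroni's inequality: each new time adds at least
    e / 2, of which the overlaps with all previous times take at most e / 4.
    The times are r * l0 apart so that the overlaps coming from common prefixes
    sum to a small multiple of e, and there are only O(1 / e) of them so that
    the nearly independent overlaps do too. *)
Lemma pr_hits W k r n (E := starts_in W) (e := pr (ev 0 E)) :
  chain W -> (forall w, W w -> (size w <= k)%N) ->
  (j0 <= r * l0)%N ->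
  q0 ^+ r <= (16 * C ^+ 2)^-1 -> (n%:R - 1) * (8 * C ^+ 2) * e <= 1 ->
  n%:R * e / 4 <= pr (ev 0 (hits (r * l0) n E)).
Proof.
move=> cW Wk j0r qr; have dE : determined k E by apply: determined_starts_in.
have dU i := @determined_hits (r * l0) i k E dE.
have mF p := mev p dE.
have C2 : 1 <= C ^+ 2 by rewrite exprn_ege1.
have e0 : 0 <= e by apply: pr_ge0.
elim: n => [|n IH]; first by rewrite !mul0r pr_ge0.
rewrite -natr1 addrK => ne.
have {}IH : n%:R * e / 4 <= pr (ev 0 (hits (r * l0) n E)).
  apply: IH; apply: le_trans ne; rewrite -!mulrA ler_wpM2r ?lerBlDr ?lerDl//.
  by rewrite !mulr_ge0// (le_trans _ C2).
pose F i := ev (r * l0 * i) E.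
have -> : ev 0 (hits (r * l0) n.+1 E) = ev 0 (hits (r * l0) n E) `|` (F n `\` ev 0 (hits (r * l0) n E)).
  apply/seteqP; split => t.
    move=> [i]; rewrite ltnS leq_eqVlt => /orP[/eqP -> Ht|ni Ht]; last by left; exists i.
    by have [?|?] := pselect (ev 0 (hits (r * l0) n E) t); [left|right].
  by move=> [[i ni ?]|[? _]]; [exists i => //; exact: leqW | exists n].
rewrite prU; last 3 first.
- exact: mev (dU n).
- by apply: measurableD; [exact: mF | exact: mev (dU n)].
- by apply/disj_set2P; rewrite setDE setICA setICr setI0.
have := pr_split P (mF (r * l0 * n)%N) (mev 0 (dU n)).
have Fn : e / 2 <= pr (F n).
  apply: pr_shift_lower dE _; case: (n) => [|n']; first by left; rewrite muln0.
  by right; rewrite (leq_trans j0r)// leq_pmulr.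
rewrite -/(F n).
have x16 : q0 ^+ r <= 16^-1.
  apply: le_trans qr _; move: C2; move: (C ^+ 2) => y y1.
  by rewrite lef_pV2 ?posrE; lra.
have x0 : 0 <= q0 ^+ r by exact: exprn_ge0.
have overlap : pr (F n `&` ev 0 (hits (r * l0) n E)) <= e / 4.
  have cover : forall m, (m <= n)%N -> pr (F n `&` ev 0 (hits (r * l0) m E)) <=
      \sum_(i < m) C ^+ 2 * (e + (q0 ^+ r) ^+ (n - i)) * e.
    elim=> [|m IHm] mn.
      rewrite big_ord0 (_ : _ `&` _ = set0) ?pr_set0//.
      by apply/seteqP; split => t // [_ []].
    rewrite big_ord_recr /=.
    apply: le_trans (_ : pr ((F n `&` ev 0 (hits (r * l0) m E)) `|` (F m `&` F n)) <= _).
      apply: le_pr.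
      - by apply: measurableI; [exact: mF | exact: mev (dU m.+1)].
      - apply: measurableU; apply: measurableI; [exact: mF|exact: mev (dU m)|exact: mF..].
      move=> t [Fnt [i]]; rewrite ltnS leq_eqVlt => /orP[/eqP -> ?|im ?].
        by right.
      by left; split => //; exists i.
    apply: le_trans (prU_le _ _ _) _.
    - by apply: measurableI; [exact: mF | exact: mev (dU m)].
    - by apply: measurableI; exact: mF.
    rewrite lerD ?IHm 1?ltnW//.
    have -> : F m `&` F n = ev (r * l0 * m) (E `&` shift ((r * (n - m)) * l0) @^-1` E).
      rewrite evI ev_shift (_ : (r * l0 * m + r * (n - m) * l0 = r * l0 * n)%N)//.
      by rewrite (mulnAC r _ l0) -mulnDr subnKC// ltnW.
    have dEE : determined (r * (n - m) * l0 + k) (E `&` shift (r * (n - m) * l0) @^-1` E).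
      apply: determinedI; last exact: determined_shift.
      by apply: determined_le dE; exact: leq_addl.
    apply: le_trans (pr_shift_upper _ dEE) _.
    rewrite expr2 -mulrA -[leRHS]mulrA ler_wpM2l//.
    by rewrite mulrA -exprM; exact: (pr_two_hits (r * (n - m)) cW Wk).
  apply: le_trans (cover n (leqnn n)) _.
  rewrite -mulr_suml -mulr_sumr big_split /= sumr_const card_ord -[e *+ n]mulr_natl.
  have x1 : q0 ^+ r < 1 by apply: le_lt_trans x16 _; rewrite invf_lt1// ltr1n.
  have := sum_expr_le n x0 x1.
  move: (\sum_(i < n) _) => S HS.
  have HS2 : S * (8 * C ^+ 2) <= 1.
    have p1 : 0 < 1 - q0 ^+ r by rewrite subr_gt0.
    apply: le_trans (_ : (q0 ^+ r / (1 - q0 ^+ r)) * (8 * C ^+ 2) <= _).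
      by rewrite ler_wpM2r// mulr_ge0// (le_trans _ C2).
    rewrite mulrAC ler_pdivrMr// mul1r.
    move: qr x16 C2; move: (q0 ^+ r) (C ^+ 2) => a b aq a16 b1.
    have : a * (16 * b) <= 1 by rewrite -ler_pdivlMr ?mul1r//; lra.
    lra.
  have : (S * (8 * C ^+ 2)) * e <= 1 * e by rewrite ler_wpM2r.
  have : n%:R * (8 * C ^+ 2) * e * e <= 1 * e by rewrite ler_wpM2r.
  have -> : C ^+ 2 * (n%:R * e + S) * e =
     (n%:R * (8 * C ^+ 2) * e * e + S * (8 * C ^+ 2) * e) / 8 by field.
  lra.
move: overlap Fn IH; move: (pr _) (pr _) (pr _) (pr _) => a b c f; lra.
Qed.

Definition avoids W N : set T :=
  [set t | forall p, (p < N)%N -> ~ starts_in W (shift p (X t))].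

Lemma measurable_ev_starts_in p W : measurable (ev p (starts_in W)).
Proof.
rewrite (_ : ev p _ = \bigcup_(w in W) ev p (starts w)).
  rewrite bigcup_mkcond; apply: countable_bigcupT_measurable => [|w].
    exact: countableP.
  by case: ifP => _ //; exact: mev (@determined_starts _ w).
by apply/seteqP; split => t [w Ww ?]; exists w.
Qed.

Lemma measurable_avoids W N : measurable (avoids W N).
Proof.
rewrite (_ : avoids W N = \bigcap_(p in `I_N) ~` ev p (starts_in W)).
  apply: bigcap_measurableType => p _; apply: measurableC.
  exact: measurable_ev_starts_in.
by apply/seteqP; split => t H p pN; exact: H.
Qed.

(** The main symbolic estimate.  The constants do not depend on the chain, and the
    time unit L is of the order of the inverse of its measure, even though the
    chain may contain arbitrarily long words. *)
Lemma pr_avoids_le : exists K q : R, [/\ 0 < K, 0 <= q, q < 1 &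
  forall W (e := pr (ev 0 (starts_in W))) L, chain W -> 0 < e -> K / e <= L%:R ->
  forall r, pr (avoids W (r * L)) <= q ^+ r].
Proof.
have C2 : 1 <= C ^+ 2 by rewrite exprn_ege1.
have C2p : 0 < C ^+ 2 by exact: lt_le_trans C2.
have [J J0 HJ] := expr_reaches q0_ge0 q0_lt1.
have C8 : 0 < 8 * C ^+ 2 by rewrite pmulr_rgt0.
have [r0 qr0 _] : exists2 j : nat, q0 ^+ j <= (8 * C ^+ 2)^-1 / 2 &
    j%:R <= J / (8 * C ^+ 2)^-1.
  by apply: HJ; rewrite ?invr_gt0 ?invf_le1//; move: C2; move: (C ^+ 2) => y; lra.
pose r := (r0 + j0 + 1)%N; pose g := (r * l0)%N.
have j0g : (j0 <= g)%N.
  by rewrite /g (leq_trans _ (leq_pmulr _ l0_gt0))// /r addn1 leqW// leq_addl.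
have g0 : (0 < g)%N by rewrite muln_gt0 l0_gt0 /r addn1.
have qr : q0 ^+ r <= (16 * C ^+ 2)^-1.
  apply: le_trans (_ : q0 ^+ r0 <= _).
    by rewrite /r -addnA exprD ler_piMr ?exprn_ge0// exprn_ile1// ltW.
  by apply: le_trans qr0 _; rewrite -invfM mulrAC -natrM.
pose h := (32 * C ^+ 2)^-1.
have C32 : 0 < 32 * C ^+ 2 by rewrite pmulr_rgt0.
have h0 : 0 < h by rewrite invr_gt0.
have h1 : h <= 1 by rewrite invf_le1//; move: C2; move: (C ^+ 2) => y; lra.
exists (g%:R * ((4 * C ^+ 2)^-1 + 1) + J * l0%:R + j0%:R), (1 - h / 2); split.
- apply: ltr_wpDr => //; apply: ltr_wpDr; first by rewrite mulr_ge0// ltW.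
  by rewrite pmulr_rgt0 ?ltr0n// addr_gt0// invr_gt0 pmulr_rgt0.
- lra.
- lra.
move=> W e L cW e0 KL s.
have e1 : e <= 1 by apply/pr_le1/measurable_ev_starts_in.
(* dropping the words of more than j * l0 letters loses at most half of e *)
have [j qj jJ] := HJ e e0 e1.
pose k := (j * l0)%N; pose Wk := bounded_words k W.
have cWk : chain Wk by move=> w w' n [Ww _] [Ww' _]; exact: cW.
have Wkk w : Wk w -> (size w <= k)%N by case.
pose E := starts_in Wk; pose e' := pr (ev 0 E).
have dE : determined k E by exact: determined_starts_in.
have ee' : e / 2 <= e'.
  have [V [dV pV EV]] := long_words j cW.
  have : e <= e' + q0 ^+ j.
    apply: le_trans (_ : pr (ev 0 E `|` ev 0 V) <= _).
      apply: le_pr; last by move=> t /EV.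
      - exact: measurable_ev_starts_in.
      - by apply: measurableU; [exact: mev dE | exact: mev dV].
    apply: le_trans (prU_le P (mev 0 dE) (mev 0 dV)) _.
    by rewrite lerD2l.
  lra.
have e'0 : 0 < e' by apply: lt_le_trans ee'; rewrite divr_gt0.
(* the largest number of times allowed by the overlap condition of pr_hits *)
pose y := (8 * C ^+ 2 * e')^-1.
have y0 : 0 <= y by rewrite invr_ge0 !mulr_ge0// ltW.
pose n := (Num.truncn y).+1.
have ny : n%:R - 1 <= y by rewrite /n -natr1 addrK truncn_le.
have yn : y <= n%:R by rewrite ltW// truncnS_gt.
have hit : h <= pr (ev 0 (hits g n E)).
  apply: le_trans (pr_hits cWk Wkk j0g qr _); last first.
    apply: le_trans (_ : y * (8 * C ^+ 2) * e' <= _).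
      apply: ler_wpM2r; first exact: ltW.
      by apply: ler_wpM2r; first exact: ltW.
    by rewrite -mulrA mulVf// mulf_neq0// gt_eqF.
  apply: le_trans (_ : y * e' / 4 <= _); last first.
    by apply: ler_wpM2r; rewrite // ler_wpM2r// ltW.
  by rewrite /y /h le_eqVlt; apply/orP; left; apply/eqP; field; rewrite gt_eqF// gt_eqF// (lt_le_trans _ C_ge1).
have block_le : (g * n + k + j0 <= L)%N.
  rewrite -(ler_nat R); apply: le_trans KL.
  rewrite ler_pdivlMr// !natrD (natrM R g n) (natrM R j l0) ![in leLHS]mulrDl.
  have ye : y * e <= (4 * C ^+ 2)^-1.
    rewrite /y mulrC ler_pdivrMr; last exact: mulr_gt0.
    have -> : (4 * C ^+ 2)^-1 * (8 * C ^+ 2 * e') = 2 * e'.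
      by field; rewrite gt_eqF// (lt_le_trans _ C_ge1).
    lra.
  rewrite lerD//; last by rewrite ler_piMr.
  rewrite lerD//.
    rewrite -mulrA ler_wpM2l//.
    apply: le_trans (_ : (y + 1) * e <= _).
      by rewrite ler_wpM2r ?(ltW e0)//; move: ny; lra.
    by rewrite mulrDl mul1r lerD.
  by rewrite mulrAC ler_wpM2r// -ler_pdivlMr.
have dH := @determined_hits g n k E dE.
have avoid := pr_avoid mX pr_gap (fun _ => dH) (fun q (_ : (q < s)%N) => hit).
apply: le_trans avoid; apply: le_pr.
- exact: measurable_avoids.
- exact: (mev 0 (determined_avoid (fun=> dH))).
move=> t Ht q qs [i ni [w [Ww _] Hw]].
apply: (Ht (q * (g * n + k + j0) + j0 + g * i)%N).
  exact: (@block_position _ _ _ _ _ k).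
by exists w => //; rewrite shift_shift in Hw.
Qed.

End hitting_time.

(** * Intervals of words and uniqueness of the coding *)

Section repeller_geometry.
Context {R : realType} {A : countType}.
Variables (I : set R) (Z : A -> set R) (f phi : R -> R).
Hypothesis hf : piecewise_monotone_map I Z f.
Hypothesis ha3 : cond_a3 I Z f phi.
Implicit Types (x y z a b : R) (s : nat -> A) (u v w : seq A) (n k : nat).

Local Notation rep := (repeller I Z f).
Local Notation Zw := (word_interval I Z f).

Lemma word_interval_mkseq s n x : Zw (mkseq s n) x <->
  (forall k, (k < n)%N -> Z (s k) (iter k f x)) /\ I (iter n f x).
Proof.
elim: n s x => [|n IH] s x; first by split=> [|[]].
have -> : mkseq s n.+1 = s 0%N :: mkseq (shift 1 s) n.
  by rewrite -add1n mkseq_add.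
split=> [[Zx /IH[H Ix]]|[H Ix]].
  split; last by rewrite iterSr.
  by case=> [//|k kn]; rewrite iterSr; exact: H.
split; first exact: (H 0%N).
apply/IH; split=> [k kn|]; last by rewrite -iterSr.
by rewrite -iterSr; exact: H.
Qed.

Lemma word_interval_sub w : Zw w `<=` I.
Proof.
case: w => [//|c w] x [/= Zx _].
exact: (pmm_branch_sub hf Zx).
Qed.

Lemma word_interval_take w n : Zw w `<=` Zw (take n w).
Proof.
elim: w n => [|c w IH] [|n] x //; first by exact: word_interval_sub.
by move=> [Zx ?]; split => //; exact: IH.
Qed.

Lemma word_interval_itv w : is_interval (Zw w).
Proof.
elim: w => [|c w IH]; first exact: pmm_interval hf.
move=> x y [Zx Wx] [Zy Wy] z /andP[xz zy].
have Zz : Z c z by apply: (pmm_branch_interval hf Zx Zy); rewrite xz.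
split => //.
have hom : {in Z c &, {homo f : x y / x <= y}} \/ {in Z c &, {homo f : x y /~ x <= y}}.
  have [H|H] := pmm_monotone hf c; [left|right] => p q /set_mem Zp /set_mem Zq;
    rewrite le_eqVlt => /orP[/eqP -> //|pq]; apply: ltW; apply: H => //; exact/mem_set.
case: hom => H; [apply: (IH _ _ Wx Wy)|apply: (IH _ _ Wy Wx)];
  by apply/andP; split; apply: H; rewrite ?inE.
Qed.

Lemma branch_inj c x y : Z c x -> Z c y -> f x = f y -> x = y.
Proof.
wlog : x y / x <= y => [W Zx Zy fxy|].
  by case: (leP x y) => [|/ltW] xy; [|symmetry]; exact: W.
rewrite le_eqVlt => /orP[/eqP//|xy] /mem_set Zx /mem_set Zy fxy.
by have [H|H] := pmm_monotone hf c;
  [have := H x y Zx Zy xy|have := H y x Zy Zx xy]; rewrite fxy ltxx.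
Qed.

Lemma branch_eq c e x y : x < y -> Z c x -> Z c y -> Z e x -> Z e y -> c = e.
Proof.
move=> xy cx cy ex ey; apply: (pmm_branch_disjoint hf) => //.
have sub h : Z h x -> Z h y -> `]x, y[%classic `<=` (Z h)°.
  move=> hx hy; rewrite -open_subsetE; last exact: itv_open.
  by move=> z /=; rewrite in_itv /= => /andP[xz zy];
    apply: (pmm_branch_interval hf hx hy); rewrite !ltW.
exists ((x + y) / 2); split; apply: sub => //=; rewrite in_itv /=; apply/andP; split; lra.
Qed.

(** Branches overlap in at most one point, and f is injective on each of them. *)
Lemma word_eq u v x y : x != y -> size u = size v ->
  Zw u x -> Zw u y -> Zw v x -> Zw v y -> u = v.
Proof.
elim: u v x y => [|c u IH] [|e v] x y //= xy [uv] [cx ux] [cy uy] [ex vx] [ey vy].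
have ce : c = e.
  by move: xy; rewrite neq_lt => /orP[xy|xy]; exact: (branch_eq xy).
rewrite ce (IH v (f x) (f y))//.
by apply: contra_neq xy; exact: (branch_inj cx cy).
Qed.

Lemma repeller_map x : rep x -> rep (f x).
Proof.
move=> [_ H]; split; last by move=> k; have := H k.+1; rewrite iterSr.
by have [c _ Zx] := H 0%N; apply: (@pmm_maps_to _ _ _ _ _ hf c); exists x.
Qed.

Lemma repeller_iter n x : rep x -> rep (iter n f x).
Proof. by move=> rx; elim: n => //= n; exact: repeller_map. Qed.

Lemma repeller_setD_hole : rep `\` hole I Z = rep.
Proof. by apply/seteqP; split => x [] // ? H; split => // -[_]; apply; exact: (H 0%N). Qed.

Lemma transfer_ge0 (psi : R -> \bar R) : (forall x, 0 <= psi x)%E ->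
  forall x, (0 <= transfer I Z f phi psi x)%E.
Proof. by move=> psi0 x; apply: esum_ge0 => y _; rewrite mule_ge0// expeR_ge0. Qed.

Lemma iter_transfer_gt0 (psi : R -> \bar R) n x : (forall x, 0 <= psi x)%E ->
  (0 < iter n (transfer I Z f phi) psi x)%E ->
  exists2 y, (0 < psi y)%E & iter n f y = x.
Proof.
move=> psi0; elim: n x => [|n IH] x; first by exists x.
have pn0 y : (0 <= iter n (transfer I Z f phi) psi y)%E.
  by elim: n y {IH} => //= n; exact: transfer_ge0.
rewrite iterS => H.
have [[y [fy]]|no] := pselect (exists y, f y = x /\ (0 < iter n (transfer I Z f phi) psi y)%E).
  by move=> /IH[z pz zy]; exists z => //; rewrite iterS zy.
exfalso; move: H; rewrite /transfer esum1 ?ltxx// => y [_ fy].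
have := pn0 y; rewrite le_eqVlt => /orP[/eqP <-|py]; first by rewrite mul0e.
by exfalso; apply: no; exists y.
Qed.

(** All the iterates of f are injective on such an interval, which is contained
    in the repeller.  Apply (a3) to a ball inside it that avoids the endpoint a:
    some f^N maps this ball onto a set containing the whole repeller,
    in particular f^N(a), against the injectivity of f^N. *)
Lemma no_homterval a b : a < b ->
  (forall k, exists c, forall y, a <= y -> y < b -> Z c (iter k f y)) -> False.
Proof.
move=> ab H.
have rJ y : a <= y -> y < b -> rep y.
  move=> ay yb; split; last by move=> k; have [c Hc] := H k; exists c => //; exact: Hc.
  by have [c Hc] := H 0%N; apply: (pmm_branch_sub hf); exact: (Hc y ay yb).
have injJ n x y : a <= x -> x < b -> a <= y -> y < b -> iter n f x = iter n f y -> x = y.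
  move=> ax xb ay yb; elim: n => // n IH E; apply: IH.
  by have [c Hc] := H n; apply: (branch_inj (Hc x ax xb) (Hc y ay yb)).
pose z := (a + b) / 2; pose r := (b - a) / 4.
have r0 : 0 < r by rewrite /r; lra.
have Bz y : ball z r y -> a < y /\ y < b.
  by rewrite /ball /= ltr_distlC /z /r => /andP[? ?]; split; lra.
have hB : ball z r `&` hole I Z = set0.
  apply/seteqP; split => y // [/Bz[ay yb] [_ nb]].
  by apply: nb; have [_] := rJ y (ltW ay) yb; move/(_ 0%N).
have rz : rep z by apply: rJ; rewrite /z; lra.
have [N] := ha3 rz r0 hB.
have ra : rep (iter N f a) by apply: repeller_iter; exact: rJ.
move=> inf_gt0.
have pos : (0 < iter N (transfer I Z f phi) (EFin \o \1_(ball z r `&` rep))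
                  (iter N f a))%E.
  apply: lt_le_trans inf_gt0 _; rewrite /inf_transfer; apply: ereal_inf_lbound.
  by exists (iter N f a) => //; rewrite repeller_setD_hole.
have [|y] := iter_transfer_gt0 _ pos; first by move=> x; rewrite lee_fin.
rewrite /= lte_fin indicE; case: (boolP (y \in _)) => [|_]; last by rewrite ltxx.
rewrite inE => -[/Bz[ay yb] _] _ E.
by have := injJ N y a (ltW ay) yb (lexx _) ab E; move: ay => /[swap] ->; rewrite ltxx.
Qed.

Lemma codes_word s n x : codes Z f s x -> I x -> Zw (mkseq s n) x.
Proof.
move=> sx Ix; apply/word_interval_mkseq; split=> [k _|]; first exact: sx.
case: n => // n; rewrite iterS; apply: (@pmm_maps_to _ _ _ _ _ hf (s n)).
by exists (iter n f x).
Qed.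

Lemma codes_between s x y z : codes Z f s x -> codes Z f s y -> I x -> I y ->
  x <= z <= y -> codes Z f s z.
Proof.
move=> sx sy Ix Iy xzy k.
have := word_interval_itv (codes_word k.+1 sx Ix) (codes_word k.+1 sy Iy) xzy.
by move=> /word_interval_mkseq[/(_ k (leqnn _))].
Qed.

Lemma codes_inj s x y : codes Z f s x -> codes Z f s y -> I x -> I y -> x = y.
Proof.
wlog : x y / x <= y => [W|].
  by case: (leP x y) => [|/ltW] xy sx sy Ix Iy; [|symmetry]; exact: W.
rewrite le_eqVlt => /orP[/eqP//|xy] sx sy Ix Iy; exfalso.
apply: (no_homterval xy) => k; exists (s k) => z xz zy.
by apply: (codes_between sx sy Ix Iy); rewrite xz ltW.
Qed.

Lemma exists_code x : rep x -> exists s, codes Z f s x.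
Proof.
move=> [_ rx]; have : forall k, exists c, Z c (iter k f x).
  by move=> k; have [c _ ?] := rx k; exists c.
by move=> /choice[s sx]; exists s.
Qed.

Lemma PiP (s : Sigma I Z f) : codes Z f (sval s) (Pi s) /\ rep (Pi s).
Proof.
have : exists x, rep x /\ codes Z f (sval s) x by case: s.
by move=> /getPex[rx sx].
Qed.

End repeller_geometry.

(** * The coding space *)

Section coding.
Context {R : realType} {A : countType}.
Variables (I : set R) (Z : A -> set R) (f phi : R -> R).
Variables (s0 : Sigma I Z f) (mut : probability (coding_space s0) R).
Implicit Types (u v w : seq A) (n k : nat).

Definition itinerary (t : coding_space s0) : nat -> A :=
  sval (t : Sigma I Z f).

Local Notation ev := (ev itinerary).
Local Notation pr := (pr mut).

Lemma cylinderE w : cylinder w = ev 0 (starts w).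
Proof. by []. Qed.

Lemma measurable_cylinder w : measurable (ev 0 (starts w)).
Proof. by apply: sub_sigma_algebra; exists w. Qed.

Lemma ev_mkseq t n : ev 0 (starts (mkseq (itinerary t) n)) t.
Proof.
rewrite -[ev _ _ _]/(mkseq _ (size (mkseq (itinerary t) n)) = _).
by rewrite size_mkseq.
Qed.

Lemma measurable_itinerary k a : measurable [set t | itinerary t k = a].
Proof.
pose D := [set w : seq A | size w = k.+1 /\ nth a w k = a].
rewrite (_ : mkset _ = \bigcup_(w in D) ev 0 (starts w)).
  rewrite bigcup_mkcond; apply: countable_bigcupT_measurable => [|w].
    exact: countableP.
  by case: ifP => _ //; exact: measurable_cylinder.
apply/seteqP; split => t /=.
  move=> ta; exists (mkseq (itinerary t) k.+1).
    by split; [rewrite size_mkseq|rewrite nth_mkseq].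
  exact: ev_mkseq.
by move=> [w [sw wk]]; rewrite /ev /starts /= sw => wE; rewrite -wk -wE nth_mkseq.
Qed.

Local Notation mev := (measurable_ev measurable_itinerary).

Lemma SigmaStar_cylinder w (t : coding_space s0) : ev 0 (starts w) t ->
  SigmaStar I Z f w.
Proof. by move=> wt; exists t. Qed.

Lemma SigmaStar_pr w : 0 < pr (ev 0 (starts w)) -> SigmaStar I Z f w.
Proof.
move=> w0; apply/set0P/eqP => w_eq0.
by move: w0; rewrite -cylinderE w_eq0 pr_set0 ltxx.
Qed.

Lemma SigmaStar_catl u v : SigmaStar I Z f (u ++ v) -> SigmaStar I Z f u.
Proof.
move=> [t]; rewrite cylinderE starts_cat => -[ut _]; exact: SigmaStar_cylinder ut.
Qed.

Lemma pr_cylinderE w : mut (cylinder w) = (pr (ev 0 (starts w)))%:E.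
Proof. by rewrite cylinderE prE//; exact: measurable_cylinder. Qed.

Section shift_invariance.
Hypothesis hf : piecewise_monotone_map I Z f.

Lemma SigmaStar_catr u v : SigmaStar I Z f (u ++ v) -> SigmaStar I Z f v.
Proof.
move=> [t]; rewrite cylinderE starts_cat => -[_ vt].
have [x [rx sx]] := svalP (t : Sigma I Z f).
have cs : coding_sequence I Z f (shift (size u) (itinerary t)).
  exists (iter (size u) f x); split; first exact: repeller_iter.
  by move=> n; rewrite -iterD addnC; exact: sx.
by exists (exist _ _ cs).
Qed.

(** Inadmissible concatenations are harmless for the upper half of (a5): their
    cylinder is empty. *)
Lemma pr_cat_quasi_bernoulli : cond_a5 mut -> exists2 C : R, 1 <= C &
  forall u v, pr (ev 0 (starts (u ++ v))) <=
              C * pr (ev 0 (starts u)) * pr (ev 0 (starts v)).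
Proof.
move=> [C C1 ha5]; exists C => [|u v]; first exact: ltW.
have [uv|nuv] := pselect (SigmaStar I Z f (u ++ v)); last first.
  have := @SigmaStar_pr (u ++ v); case: ltP => [_ /(_ isT)//|uv0 _].
  by rewrite (le_trans uv0)// !mulr_ge0 ?pr_ge0// (le_trans _ (ltW C1)).
have /andP[_] := ha5 u v (SigmaStar_catl uv) (SigmaStar_catr uv) uv.
by rewrite !pr_cylinderE -!EFinM lee_fin.
Qed.

End shift_invariance.

(** It suffices to take gamma(j0) <= 1/2; summing over the words in the gap
    removes the question of which concatenations are admissible. *)
Lemma pr_gap_mixing : cond_a6 mut -> exists j0,
  forall u v, 2^-1 * pr (ev 0 (starts u)) * pr (ev 0 (starts v)) <=
              pr (ev 0 (starts u) `&` ev (size u + j0) (starts v)).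
Proof.
move=> [gamma /cvgrPdist_le gamma0 ha6].
have [j _ hj] := gamma0 2^-1 ltac:(by rewrite invr_gt0).
have {hj} : `|0 - gamma j| <= 2^-1 by exact: hj (leqnn j).
rewrite sub0r normrN => /(le_trans (ler_norm _)) gj; exists j => u v.
have [u0|u0] := leP (pr (ev 0 (starts u))) 0.
  have -> : pr (ev 0 (starts u)) = 0 by apply/eqP; rewrite eq_le u0 pr_ge0.
  by rewrite mulr0 mul0r pr_ge0.
have [v0|v0] := leP (pr (ev 0 (starts v))) 0.
  have -> : pr (ev 0 (starts v)) = 0 by apply/eqP; rewrite eq_le v0 pr_ge0.
  by rewrite mulr0 pr_ge0.
have := ha6 u v j (SigmaStar_pr u0) (SigmaStar_pr v0).
rewrite !pr_cylinderE !lte_fin => /(_ u0 v0) /=.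
set B := bigcup _ _.
have mB : @measurable _ (coding_space s0) B.
  rewrite /B bigcup_mkcond; apply: countable_bigcupT_measurable => [|w].
    exact: countableP.
  by case: ifP => _ //; exact: measurable_cylinder.
have BE : B `<=` ev 0 (starts u) `&` ev (size u + j) (starts v).
  move=> t [w [sw _]]; rewrite cylinderE catA starts_cat size_cat sw => -[].
  by rewrite starts_cat => -[? _] ?.
have : pr B <= pr (ev 0 (starts u) `&` ev (size u + j) (starts v)).
  apply: le_pr => //; apply: measurableI; first exact: measurable_cylinder.
  exact: mev (@determined_starts _ v).
rewrite -[fine (mut B)]/(pr B) => PB /le_trans/(_ gj).
rewrite ler_distl => /andP[H _].
have uv0 : 0 < pr (ev 0 (starts u)) * pr (ev 0 (starts v)) by rewrite mulr_gt0.
apply: le_trans PB; rewrite -mulrA -ler_pdivlMr//.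
by apply: le_trans H; lra.
Qed.

Section no_atom.
Hypothesis hf : piecewise_monotone_map I Z f.
Hypothesis ha3 : cond_a3 I Z f phi.
Variable mu : probability (measurableTypeR R) R.
Hypothesis mu1 : forall x : R, mu [set x] = 0%E.
Hypothesis mut_Pi : forall B : set (measurableTypeR R), measurable B ->
  mu B = mut (@Pi _ _ I Z f @^-1` B).

(** The intervals of the prefixes of an itinerary shrink to the point it codes,
    so Pi(t) < x holds exactly when the interval of some prefix of t lies to
    the left of x. *)
Lemma measurable_Pi :
  measurable_fun setT (@Pi _ _ I Z f : coding_space s0 -> measurableTypeR R).
Proof.
apply: (measurability _ (measurable_realfun.RGenInftyO.measurableE R)).
move=> _ [_ [x ->] <-]; rewrite setTI.
pose D := [set w | word_interval I Z f w `<=` `]-oo, x[%classic].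
rewrite (_ : _ @^-1` _ = \bigcup_(w in D) ev 0 (starts w)).
  rewrite bigcup_mkcond; apply: countable_bigcupT_measurable => [|w].
    exact: countableP.
  by case: ifP => _ //; exact: measurable_cylinder.
apply/seteqP; split => t.
  have [tP rP] := PiP (t : Sigma I Z f).
  have [IP _] := rP; rewrite /= in_itv /= => Px; apply: contrapT => H.
  have tx : codes Z f (sval (t : Sigma I Z f)) x /\ I x.
    have W n : word_interval I Z f (mkseq (itinerary t) n) x.
      apply: contrapT => Wx; apply: H; exists (mkseq (itinerary t) n); last exact: ev_mkseq.
      move=> y Wy; rewrite /= in_itv /= ltNge; apply/negP => xy; apply: Wx.
      by apply: (word_interval_itv hf (codes_word hf n tP IP) Wy); rewrite (ltW Px).
    split; last exact: (W 0%N).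
    by move=> n; have /word_interval_mkseq[/(_ n (leqnn _))] := W n.+1.
  by move: Px; rewrite (codes_inj hf ha3 tP tx.1 IP tx.2) ltxx.
move=> [w Dw wt].
have [tP [IP _]] := PiP (t : Sigma I Z f).
by apply: Dw; rewrite -wt; exact: codes_word.
Qed.

(** Otherwise, for every k, a single word of length k has full measure; these
    words are compatible and isolate one itinerary, whose image would be an atom
    of mu. *)
Lemma pr_word_lt1 : exists k, exists2 eta : R, 0 < eta &
  forall w, size w = k -> pr (ev 0 (starts w)) <= 1 - eta.
Proof.
apply: contrapT => H.
have big k eta : 0 < eta -> exists2 w, size w = k & 1 - eta < pr (ev 0 (starts w)).
  move=> eta0; apply: contrapT => no; apply: H; exists k, eta => // w wk.
  by rewrite leNgt; apply/negP => ?; apply: no; exists w.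
have full k : exists w, size w = k /\ pr (ev 0 (starts w)) = 1.
  have [w wk w2] := big k 2^-1 ltac:(by rewrite invr_gt0).
  exists w; split => //; apply/le_anti/andP; split.
    by apply: pr_le1; exact: measurable_cylinder.
  rewrite leNgt; apply/negP => w1.
  have eta0 : 0 < Num.min 2^-1 (1 - pr (ev 0 (starts w))).
    by rewrite lt_min invr_gt0 subr_gt0 w1 ltr0n.
  have [w' w'k w'2] := big k _ eta0.
  have ww' : w <> w'.
    move=> ww'; move: w'2; rewrite -ww' ltrBlDr -ltrBlDl.
    by rewrite lt_min ltxx andbF.
  have := pr_le1 mut (measurableU _ _ (measurable_cylinder w) (measurable_cylinder w')).
  rewrite prU; [|exact: measurable_cylinder|exact: measurable_cylinder|].
    have : Num.min 2^-1 (1 - pr (ev 0 (starts w))) <= 2^-1 by rewrite ge_min lexx.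
    lra.
  apply/disj_set2P/seteqP; split => t // -[].
  by rewrite /ev /starts /= wk w'k => -> ?; apply: ww'.
have [W HW] := choice full.
pose N := \bigcup_k ~` ev 0 (starts (W k)).
have mN : measurable N.
  by apply: bigcup_measurable => k _; apply: measurableC; exact: measurable_cylinder.
have N0 : mut N = 0%E.
  apply/eqP; rewrite -measure_le0; apply: le_trans (le_mu_bigcup _ _ mN) _.
    by move=> k; apply: measurableC; exact: measurable_cylinder.
  rewrite eseries0 => [|k _ _]; first exact: lexx.
  rewrite [LHS]probability_setC; last exact: measurable_cylinder.
  by rewrite -cylinderE pr_cylinderE (HW k).2 subee.
have NC : mut (~` N) = 1%E by rewrite probability_setC// N0 sube0.
have [t0 t0N] : exists t, (~` N) t.
  apply: contrapT => no; have E : ~` N = set0.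
    by apply/seteqP; split => t // Nt; apply: no; exists t.
  by move: NC; rewrite E measure0 => /eqP; rewrite eqe eq_sym oner_eq0.
have mP : measurable (@Pi _ _ I Z f @^-1` [set Pi (t0 : Sigma I Z f)] : set (coding_space s0)).
  by rewrite -[X in measurable X]setTI; apply: measurable_Pi.
have : (mut (~` N) <= mut (@Pi _ _ I Z f @^-1` [set Pi (t0 : Sigma I Z f)]))%E.
  apply: le_measure; rewrite ?inE//; first exact: measurableC.
  move=> t tN; have tW k : ev 0 (starts (W k)) t.
    by apply: contrapT => ?; apply: tN; exists k.
  have t0W k : ev 0 (starts (W k)) t0.
    by apply: contrapT => ?; apply: t0N; exists k.
  have E : sval (t : Sigma I Z f) = sval (t0 : Sigma I Z f).
    apply/funext => k; have := tW k.+1; have := t0W k.+1.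
    rewrite /ev /starts /= (HW _).1 => <- /eq_mkseqP; exact.
  rewrite /=; have [tP [IP _]] := PiP (t : Sigma I Z f).
  have [tP0 [IP0 _]] := PiP (t0 : Sigma I Z f).
  by apply: (codes_inj hf ha3 tP _ IP IP0); rewrite E.
by rewrite -mut_Pi// mu1 NC lee_fin ler10.
Qed.

End no_atom.
End coding.

(** * The repeller is contained in the support of mu *)

Section support.
Context {R : realType} {A : countType}.
Variables (I : set R) (Z : A -> set R) (f phi : R -> R).
Hypothesis hf : piecewise_monotone_map I Z f.
Hypothesis ha3 : cond_a3 I Z f phi.
Variable mu : probability (measurableTypeR R) R.
Hypothesis hAdj : cond_Adj I Z f mu.
Implicit Types (x y z : R) (U V : set R) (w : seq A) (n k : nat).
Local Notation rep := (repeller I Z f).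
Local Notation Zw := (word_interval I Z f).

Lemma in_branches_word n U : in_branches I Z f n U ->
  exists2 w, size w = n & U `<=` Zw w.
Proof.
case: n => [|n] [_ U0 UI HU]; first by exists [::].
have [c0 _] := HU 0%N isT.
have : forall k, exists c, (k < n.+1)%N -> iter k f @` U `<=` Z c.
  move=> k; have [kn|nk] := ltnP k n.+1; last by exists c0.
  by have [c ?] := HU k kn; exists c.
move=> /choice[s Hs]; exists (mkseq s n.+1); first by rewrite size_mkseq.
move=> x Ux; apply/word_interval_mkseq; split=> [k kn|].
  by apply: (Hs k kn); exists x.
rewrite iterS; apply: (@pmm_maps_to _ _ _ _ _ hf (s n)).
by exists (iter n f x) => //; apply: (Hs n (leqnn _)); exists x.
Qed.

Lemma word_in_branches w : Zw w !=set0 -> in_branches I Z f (size w) (Zw w).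
Proof.
move=> w0; split => //; [exact: word_interval_itv|exact: word_interval_sub|].
case: w w0 => // c0 w _ k kw; exists (nth c0 (c0 :: w) k) => _ [x + <-].
by rewrite -{1}(mkseq_nth c0 (c0 :: w)) => /word_interval_mkseq[/(_ k kw)].
Qed.

(** The interval of a word of length n is maximal unless it is a single point
    that lies in the interval of another word; the latter is then maximal. *)
Lemma ncylinder_extend n U : in_branches I Z f n U ->
  exists2 V, ncylinders I Z f n V & U `<=` V.
Proof.
move=> nU; have [w wn Uw] := in_branches_word nU.
have w0 : Zw w !=set0 by have [_ [x /Uw ?] _ _] := nU; exists x.
have nw : in_branches I Z f n (Zw w) by rewrite -wn; exact: word_in_branches.
have [max|] := pselect (ncylinders I Z f n (Zw w)); first by exists (Zw w).
move=> /not_andP[//|/existsNP[V /not_implyP[nV /not_implyP[wV Vw]]]].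
have [w' wn' Vw'] := in_branches_word nV.
have [x wx] := w0.
have [y Vy wy] : exists2 y, V y & ~ Zw w y.
  apply: contrapT => no; apply: Vw; apply/seteqP; split => // y Vy.
  by apply: contrapT => ?; apply: no; exists y.
have xy : x != y by apply/eqP => xy; apply: wy; rewrite -xy.
have w'x := Vw' _ (wV _ wx); have w'y := Vw' _ Vy.
exists (Zw w'); last by move=> z /Uw/wV/Vw'.
split; first by rewrite -wn'; apply: word_in_branches; exists x.
move=> V' nV' w'V'; have [w2 wn2 V'w2] := in_branches_word nV'.
have E : w' = w2.
  by apply: (word_eq hf xy) => //; [rewrite wn'|exact/V'w2/w'V'..].
by apply/seteqP; split => // z /V'w2; rewrite -E.
Qed.

(** The comparison of adjacent cylinders in (Adj) has the measure of U in the
    numerator and a positive lower bound. *)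
Lemma ncylinder_mu_gt0 n U : ncylinders I Z f n.+1 U -> 0 < fine (mu U).
Proof.
move=> cU; have [[UI U0 UsI HU] _] := cU.
have [P cP UP] : exists2 P, ncylinders I Z f n P & U `<=` P.
  by apply: ncylinder_extend; split => // k kn; apply: HU; exact: leqW.
have [[C C0 H1] H2] := hAdj.
have [V [cV adj]] := H2 n P U cP (conj cU UP).
have /andP[+ _] := H1 n P U V cP (conj cU UP) cV adj.
rewrite lt_neqAle fine_ge0// andbT; case: eqP => // <-.
by rewrite mul0r invr_le0 leNgt C0.
Qed.

(** If a ball around x were null, every cylinder containing x would stick out of
    it, always on the same side for infinitely many lengths, and a one-sided
    neighbourhood of x would stay inside single branches forever. *)
Lemma repeller_sub_supp : rep `<=` supp mu.
Proof.
move=> x rx r r0; rewrite ltNge; apply/negP => Br.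
have mB : @measurable _ (measurableTypeR R) (ball x r) by exact: measurable_ball.
have [s sx] := exists_code rx.
have big n : exists U, [/\ in_branches I Z f n.+1 U, U x & ~ U `<=` ball x r].
  have sw : Zw (mkseq s n.+1) x by apply: codes_word => //; case: rx.
  have : in_branches I Z f n.+1 (Zw (mkseq s n.+1)).
    have := @word_in_branches (mkseq s n.+1); rewrite size_mkseq; apply.
    by exists x.
  move=> /ncylinder_extend[U cU Uw]; exists U; split; [by case: cU|exact: Uw|].
  move=> UB; have := ncylinder_mu_gt0 cU.
  have mU : @measurable _ (measurableTypeR R) U.
    by apply: is_interval_measurable; have [[]] := cU.
  have : (mu U <= mu (ball x r))%E by apply: le_measure; rewrite ?inE.
  move=> /le_trans/(_ Br); rewrite measure_le0 => /eqP ->.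
  by rewrite ltxx.
pose J e := if e then `[x, x + r[%classic else `]x - r, x]%classic.
have side n : exists e, forall k, (k <= n)%N ->
    exists c, forall y, J e y -> Z c (iter k f y).
  have [U [nU Ux UB]] := big n.
  have [y Uy xy] : exists2 y, U y & ~ ball x r y.
    apply: contrapT => no; apply: UB => y Uy; apply: contrapT => ?; apply: no.
    by exists y.
  have [e Je] : exists e, J e `<=` U.
    have [UI _ _ _] := nU.
    have {}xy : (y <= x - r) || (x + r <= y).
      apply: contrapT => /negP; rewrite negb_or -!ltNge => /andP[? ?].
      by apply: xy; rewrite /ball /= ltr_distlC; apply/andP.
    case/orP: xy => xy; [exists false|exists true] => z; rewrite /J /= in_itv /= => /andP[? ?].
      by apply: (UI _ _ Uy Ux); apply/andP; split => //; lra.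
    by apply: (UI _ _ Ux Uy); apply/andP; split => //; lra.
  exists e => k kn; have [_ _ _ /(_ k kn)[c Hc]] := nU.
  by exists c => z /Je Uz; apply: Hc; exists z.
have [e He] : exists e, forall k, exists c, forall y, J e y -> Z c (iter k f y).
  have [right|] := pselect (forall n, exists c, forall y, J true y -> Z c (iter n f y)).
    by exists true.
  move=> /existsNP[n0 Hn0]; exists false => k.
  have [[] He] := side (maxn n0 k); last exact: (He k (leq_maxr _ _)).
  by exfalso; apply: Hn0; exact: (He n0 (leq_maxl _ _)).
have [a [b [ab Jab]]] : exists a b, a < b /\ forall y, a <= y -> y < b -> J e y.
  case: e He => _; [exists x, (x + r)|exists (x - r / 2), x]; split; try lra.
    by move=> y ? ?; rewrite /J /= in_itv /=; apply/andP.
  by move=> y ? ?; rewrite /J /= in_itv /=; apply/andP; split; lra.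
apply: (no_homterval hf ha3 ab) => k; have [c Hc] := He k.
by exists c => y ay yb; apply/Hc/Jab.
Qed.

End support.

(** * Finite nets and the minimal measure of a ball *)

Lemma real_ballP (R : realType) (x r y : R) :
  ball x r y <-> x - r < y < x + r.
Proof. by rewrite -ltr_distlC. Qed.

Lemma finite_net (R : realType) (I : set R) : bounded_set I ->
  exists2 K : R, 0 < K & forall (D : set R) (h : R), D `<=` I -> 0 < h ->
  exists xs : seq R, [/\ (forall x, x \in xs -> D x), (size xs)%:R <= K / h + 1 &
    forall y, D y -> exists2 x, x \in xs & `|y - x| < h].
Proof.
move=> /ex_strict_bound_gt0[K K0 IK]; exists (2 * K); first by rewrite mulr_gt0.
move=> D h DI h0; pose cell y := Num.truncn ((y + K) / h).
pose top := Num.truncn (2 * K / h).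
have pos y : D y -> 0 <= (y + K) / h.
  by move=> /DI/IK /=; rewrite ltr_norml => /andP[? _]; rewrite divr_ge0 ?(ltW h0)//; lra.
have cell_top y : D y -> (cell y < top.+1)%N.
  move=> /DI/IK /=; rewrite ltr_norml => /andP[_ yK]; rewrite ltnS; apply: le_truncn.
  by rewrite ler_wpM2r ?invr_ge0 ?(ltW h0)//; lra.
have near_cell x y : D x -> D y -> cell x = cell y -> `|y - x| < h.
  have itv z : D z -> (cell z)%:R <= (z + K) / h < (cell z).+1%:R.
    by move=> /pos z0; rewrite truncn_le z0 truncnS_gt.
  move=> Dx Dy xy; have := itv x Dx; have := itv y Dy; rewrite xy.
  rewrite -natr1 !ler_pdivlMr// !ltr_pdivrMr// mulrDl mul1r.
  move: (_%:R * h) => c /andP[? ?] /andP[? ?].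
  by rewrite ltr_norml; apply/andP; split; lra.
(* one point is chosen in each cell of length h that meets D *)
pose P j := `[< exists y, D y /\ cell y = j >].
pose xs := [seq get [set y | D y /\ cell y = j] | j <- iota 0 top.+1 & P j].
exists xs; split.
- move=> x /mapP[j]; rewrite mem_filter => /andP[/asboolP Pj _] ->.
  by have [] := getPex Pj.
- rewrite size_map; apply: le_trans (_ : top.+1%:R <= _).
    by rewrite ler_nat size_filter (leq_trans (count_size _ _))// size_iota.
  by rewrite -natr1 lerD2r truncn_le divr_ge0// ?mulr_ge0// ltW.
move=> y Dy; have Pc : P (cell y) by apply/asboolP; exists y.
have [Dx xy] := getPex (asboolW Pc).
exists (get [set z | D z /\ cell z = cell y]); last exact: near_cell.
by apply/mapP; exists (cell y) => //; rewrite mem_filter Pc mem_iota add0n cell_top.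
Qed.

Section minimal_ball_facts.
Context {R : realType}.
Variable mu : probability (measurableTypeR R) R.
Implicit Types (d x : R).

Lemma mu_ball x d : mu (ball x d) = (fine (mu (ball x d)))%:E.
Proof. by rewrite (prE mu)//; exact: measurable_ball. Qed.

Lemma min_ball_le x d : supp mu x -> min_ball mu d <= fine (mu (ball x d)).
Proof.
move=> sx; apply: ge_inf; last by exists x.
by exists 0 => _ [y _ <-]; exact: fine_ge0.
Qed.

Lemma min_ball_le1 d : supp mu !=set0 -> min_ball mu d <= 1.
Proof.
move=> [x sx]; apply: le_trans (min_ball_le d sx) _.
by apply: (pr_le1 mu); exact: measurable_ball.
Qed.

(** Every ball centred in the support meets D, hence contains one of the
    finitely many smaller balls centred at the points of a net of D. *)
Lemma min_ball_gt0 (I D : set R) d : measurable (D : set (measurableTypeR R)) ->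
  bounded_set I -> D `<=` I -> mu D = 1%E -> D `<=` supp mu -> 0 < d -> 0 < min_ball mu d.
Proof.
move=> mD bI DI D1 Dsupp d0.
have [K K0 net] := finite_net bI.
have d2 : 0 < d / 2 by rewrite divr_gt0.
have [xs [xsD _ xs_net]] := net D (d / 2) DI d2.
pose c := \big[Num.min/1]_(x <- xs) fine (mu (ball x (d / 4))).
have c0 : 0 < c.
  rewrite /c big_seq; apply: (big_ind (fun a => 0 < a)) => // [a b a0 b0|x /xsD/Dsupp sx].
    by rewrite lt_min a0.
  by rewrite -lte_fin -mu_ball; apply: sx; rewrite divr_gt0.
apply: (lt_le_trans c0); apply: lb_le_inf.
  have [x Dx] : exists x, D x.
    apply: contrapT => no; have E : D = set0.
      by apply/seteqP; split => x // Dx; apply: no; exists x.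
    by move: D1; rewrite E measure0 => /eqP; rewrite eqe eq_sym oner_eq0.
  by exists (fine (mu (ball x d))), x => //; exact: Dsupp.
move=> _ [y sy <-].
have [z Dz yz] : exists2 z, D z & ball y (d / 4) z.
  apply: contrapT => no; have : (0 < mu (ball y (d / 4)))%E.
    by apply: sy; rewrite divr_gt0.
  apply/negP; rewrite -leNgt -(_ : mu (~` D) = 0%E).
    apply: le_measure; rewrite ?inE.
    - exact: measurable_ball.
    - exact: measurableC.
    by move=> z yz Dz; apply: no; exists z.
  by rewrite probability_setC// D1 subee.
have [x xxs zx] := xs_net z Dz.
apply: le_trans (_ : fine (mu (ball x (d / 4))) <= _).
  by rewrite /c; exact: ge_bigmin_seq.
apply: (@le_pr _ _ _ mu); [exact: measurable_ball|exact: measurable_ball|].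
move=> t /real_ballP/andP[? ?]; apply/real_ballP.
move: yz zx => /real_ballP/andP[? ?]; rewrite ltr_norml => /andP[? ?].
by apply/andP; split; lra.
Qed.

Lemma min_ball_near d (a : R) : 1 < a -> supp mu !=set0 -> 0 < min_ball mu d ->
  exists2 x, supp mu x & fine (mu (ball x d)) < a * min_ball mu d.
Proof.
move=> a1 [x0 sx0] M0.
have e0 : 0 < (a - 1) * min_ball mu d by rewrite mulr_gt0 ?subr_gt0.
have hi : has_inf [set fine (mu (ball x d)) | x in supp mu].
  split; first by exists (fine (mu (ball x0 d))), x0.
  by exists 0 => _ [y _ <-]; exact: fine_ge0.
have [_ [x sx <-] H] := inf_adherent e0 hi.
by exists x => //; apply: lt_le_trans H _; rewrite -/(min_ball mu d); lra.
Qed.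

End minimal_ball_facts.

(** * From hitting times to the expected cover time *)

(** With tau not assumed to be measurable, the expectation is bounded through
    a measurable majorant: r0 * L plus L for each later event B r that occurs.  Starting the sum at r0 makes it harmless that N is large. *)
Lemma geometric_tail_majorant d (T : measurableType d) (R : realType)
  (P : probability T R) (tau : T -> \bar R) (B : nat -> set T)
  (L r0 : nat) (N q : R) :
  (0 < L)%N -> 0 <= N -> 0 <= q -> q < 1 -> (forall r, measurable (B r)) ->
  (forall r, pr P (B r) <= N * q ^+ r) ->
  (forall r t, (r0 <= r)%N -> ~ B r t -> (tau t <= ((r * L)%:R)%:E)%E) ->
  exists g : T -> \bar R, [/\ measurable_fun setT g, (forall t, 0 <= g t)%E,
    (forall t, tau t <= g t)%E &
    (\int[P]_t g t <= (L%:R * (r0%:R + N * q ^+ r0 / (1 - q)))%:E)%E].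
Proof.
move=> L0 N0 q0 q1 mB PB tauB; have p0 : 0 < 1 - q by rewrite subr_gt0.
pose u n t : \bar R := (L%:R%:E * (\1_(B (r0 + n)%N) t)%:E)%E.
have u0 n t : (0 <= u n t)%E by rewrite mule_ge0 ?lee_fin.
have mu_ n : measurable_fun setT (u n).
  apply: measurable_funeM; apply/measurable_EFinP.
  exact: measurable_indic.
pose S t := (\sum_(0 <= n <oo) u n t)%E.
have S0 t : (0 <= S t)%E by apply: nneseries_ge0.
have mS : measurable_fun setT S by apply: ge0_emeasurable_sum.
have partial t n : (forall i, (i < n)%N -> B (r0 + i)%N t) -> ((n * L)%:R%:E <= S t)%E.
  move=> H; apply: le_trans (nneseries_lim_ge n _) => //.
  rewrite big_mkord (eq_bigr (fun=> L%:R%:E)); last first.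
    by move=> i _; rewrite /u indicE mem_set ?mule1//; exact: H.
  by rewrite sumEFin sumr_const card_ord lee_fin mulnC natrM mulr_natr.
exists (fun t => (r0 * L)%:R%:E + S t)%E; split.
- by apply: emeasurable_funD => //; exact: measurable_cst.
- by move=> t; rewrite adde_ge0// lee_fin.
- move=> t; have [[n Bn]|all] := pselect (exists n, ~ B (r0 + n)%N t).
    have ex : exists n, `[< ~ B (r0 + n)%N t >] by exists n; apply/asboolP.
    case: (ex_minnP ex) => k /asboolP Bk kmin.
    apply: le_trans (tauB _ _ (leq_addr k r0) Bk) _.
    rewrite mulnDl natrD EFinD leeD2l//; apply: partial => i ik.
    apply: contrapT => Bi; have := kmin i; rewrite leqNgt ik => H.
    by have := H (asboolT Bi).
  suff -> : S t = +oo%E by rewrite addey// leey.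
  apply/eqyP => a a0; apply: le_trans (partial t (Num.truncn a).+1 _).
    rewrite lee_fin ltW// (lt_le_trans (truncnS_gt a))// ler_nat.
    by rewrite leq_pmulr.
  by move=> i _; apply: contrapT => ?; apply: all; exists i.
rewrite ge0_integralD//.
have -> : (\int[P]__ ((r0 * L)%:R)%:E = ((r0 * L)%:R)%:E)%E.
  have := integral_cst P (@measurableT _ T) ((r0 * L)%:R)%:E.
  by rewrite [X in (_ * X)%E](_ : _ = 1%E) ?mule1//; exact: probability_setT.
rewrite integral_nneseries//.
rewrite mulrDr EFinD -natrM mulnC leeD2l//.
apply: lime_le; first by apply: is_cvg_nneseries => n _ _; exact: integral_ge0.
apply: nearW => n.
apply: (@le_trans _ _ (\sum_(0 <= i < n) (L%:R * (N * q ^+ (r0 + i)))%:E)%E).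
  apply: lee_sum => i _.
  rewrite /u ge0_integralZl_EFin//; last first.
    by apply/measurable_EFinP; exact: measurable_indic.
  rewrite integral_indic// setIT EFinM lee_wpmul2l ?lee_fin//.
  have PE := prE P (mB (r0 + i)%N).
  by rewrite [leLHS]PE lee_fin.
rewrite sumEFin lee_fin -mulr_sumr ler_wpM2l// big_mkord.
rewrite -mulr_sumr -mulrA ler_wpM2l//.
rewrite (eq_bigr (fun i : 'I_n => q ^+ r0 * q ^+ i)); last by move=> i _; rewrite exprD.
rewrite -mulr_sumr ler_wpM2l ?exprn_ge0//.
rewrite -(@ler_pM2r _ (1 - q))// mulVf ?gt_eqF//.
have -> : (\sum_(i < n) q ^+ i) * (1 - q) = 1 - q ^+ n.
  by rewrite -[RHS]opprB subrX1 -mulNr opprB mulrC.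
by rewrite lerBlDr lerDl exprn_ge0.
Qed.

Section cover_time_upper.
Context {R : realType} {A : countType}.
Variables (I : set R) (Z : A -> set R) (f phi : R -> R).
Hypothesis hf : piecewise_monotone_map I Z f.
Hypothesis ha3 : cond_a3 I Z f phi.
Variables (s0 : Sigma I Z f) (mut : probability (coding_space s0) R).
Variable mu : probability (measurableTypeR R) R.
Hypothesis mut_Pi : forall B : set (measurableTypeR R), measurable B ->
  mu B = mut (@Pi _ _ I Z f @^-1` B).
Implicit Types (x y z d : R) (w : seq A) (n k : nat).
Local Notation rep := (repeller I Z f).
Local Notation Zw := (word_interval I Z f).
Local Notation X := (@itinerary _ _ I Z f s0).
Local Notation PiC := (fun t : coding_space s0 => Pi (t : Sigma I Z f)).

(** Meant for a ball B and one half J of an annulus along its boundary: an interval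
    that sticks out of B and contains a point near the centre contains J. *)
Definition entering (B J : set R) : set (seq A) :=
  [set w | Zw w `<=` B /\ forall n, (n < size w)%N -> J `<=` Zw (take n w)].

Lemma chain_entering B J x y : x != y -> J x -> J y -> chain (entering B J).
Proof.
move=> xy Jx Jy w w' n [_ Hw] [_ Hw'] nw nw'.
have Jw := Hw n nw; have Jw' := Hw' n nw'.
apply: (word_eq hf xy); last 4 first.
- exact: Jw.
- exact: Jw.
- exact: Jw'.
- exact: Jw'.
by rewrite !size_takel// ltnW.
Qed.

(** The first prefix of the itinerary whose interval is inside the larger ball;
    the previous interval contains the coded point, in the smaller ball, and
    a point outside the larger one, hence half of the annulus between them. *)
Lemma entering_cover x a b (t : coding_space s0) : 0 < a -> a < b ->
  ball x a (PiC t) ->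
  starts_in (entering (ball x b) `[x + a, x + b[%classic) (X t) \/
  starts_in (entering (ball x b) `]x - b, x - a]%classic) (X t).
Proof.
move=> a0 ab /real_ballP/andP[xP Px].
have [tP [IP _]] := PiP (t : Sigma I Z f).
pose W n := Zw (mkseq (X t) n).
have WP n : W n (PiC t) by exact: codes_word.
have Wanti m n : (m <= n)%N -> W n `<=` W m.
  move=> mn; rewrite /W -(take_drop_mkseq (X t) (m := 0) mn) drop0.
  exact: word_interval_take.
have Witv n : is_interval (W n) by exact: word_interval_itv.
have leave y : y != PiC t -> exists n, ~ W n y.
  move=> yP; apply: contrapT => no; move/eqP: yP; apply.
  have Wy n : W n y by apply: contrapT => ?; apply: no; exists n.
  apply: (codes_inj hf ha3 (s := X t)) => //; last exact: (Wy 0%N).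
  by move=> n; have /word_interval_mkseq[/(_ n (leqnn _))] := Wy n.+1.
have inside : exists n, `[< W n `<=` ball x b >].
  have [|n1 H1] := leave (x + b); first by rewrite gt_eqF//; lra.
  have [|n2 H2] := leave (x - b); first by rewrite lt_eqF//; lra.
  exists (maxn n1 n2); apply/asboolP => y Wy; apply/real_ballP.
  have Wn := WP (maxn n1 n2); rewrite !ltNge -negb_or; apply/negP => /orP[yb|yb].
    apply: H2; apply: (Wanti n2 _ (leq_maxr _ _)).
    by apply: (Witv _ _ _ Wy Wn); apply/andP; split; lra.
  apply: H1; apply: (Wanti n1 _ (leq_maxl _ _)).
  by apply: (Witv _ _ _ Wn Wy); apply/andP; split; lra.
case: (ex_minnP inside) => n /asboolP Wn nmin.
have startsW : starts (mkseq (X t) n) (X t) by rewrite /starts /mkset size_mkseq.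
suff : exists J, (J = `[x + a, x + b[%classic \/ J = `]x - b, x - a]%classic) /\
    forall m, (m < n)%N -> J `<=` W m.
  move=> [J [EJ HJ]].
  have : entering (ball x b) J (mkseq (X t) n).
    split=> // m; rewrite size_mkseq => mn.
    by rewrite -[mkseq _ n]drop0 take_drop_mkseq ?add0n 1?ltnW//; exact: HJ.
  by case: EJ => <- ?; [left|right]; exists (mkseq (X t) n).
case: n => [|n] in Wn nmin startsW *; first by eexists; split; [left|].
have [y Wy yB] : exists2 y, W n y & ~ ball x b y.
  apply: contrapT => no; have := nmin n; rewrite ltnn => H.
  suff /asboolP/H : W n `<=` ball x b by [].
  by move=> y Wy; apply: contrapT => ?; apply: no; exists y.
have {}yB : (y <= x - b) || (x + b <= y).
  apply: contrapT => /negP; rewrite negb_or -!ltNge => H; apply: yB.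
  exact/real_ballP.
case/orP: yB => yb.
  exists `]x - b, x - a]%classic; split=> [|m mn z]; first by right.
  rewrite /= in_itv /= => /andP[? ?]; apply: (Wanti m n mn).
  by apply: (Witv _ _ _ Wy (WP n)); apply/andP; split; lra.
exists `[x + a, x + b[%classic; split=> [|m mn z]; first by left.
rewrite /= in_itv /= => /andP[? ?]; apply: (Wanti m n mn).
by apply: (Witv _ _ _ (WP n) Wy); apply/andP; split; lra.
Qed.

Lemma exists_target x a b : 0 < a -> a < b -> exists W : set (seq A),
  [/\ chain W, (forall w, W w -> Zw w `<=` ball x b) &
      fine (mu (ball x a)) / 2 <= pr mut (ev X 0 (starts_in W))].
Proof.
move=> a0 ab; have mB : @measurable _ (measurableTypeR R) (ball x a).
  exact: measurable_ball.
pose Wr := entering (ball x b) `[x + a, x + b[%classic.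
pose Wl := entering (ball x b) `]x - b, x - a]%classic.
have mX := @measurable_itinerary _ _ I Z f s0.
have mE W := measurable_ev_starts_in mX 0 W.
have mP := measurable_Pi (s0:=s0) hf ha3.
have : fine (mu (ball x a)) <= pr mut (ev X 0 (starts_in Wr)) + pr mut (ev X 0 (starts_in Wl)).
  rewrite mut_Pi//; apply: le_trans (prU_le mut (mE _) (mE _)).
  apply: le_pr; last by move=> t; exact: entering_cover.
  - by rewrite -[X in measurable X]setTI; exact: mP.
  - exact: measurableU.
have cr : chain Wr.
  by apply: (@chain_entering _ _ (x + a) ((x + a + (x + b)) / 2));
    rewrite ?lt_eqF//= ?in_itv/=; try (apply/andP; split); lra.
have cl : chain Wl.
  by apply: (@chain_entering _ _ (x - a) ((x - a + (x - b)) / 2));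
    rewrite ?gt_eqF//= ?in_itv/=; try (apply/andP; split); lra.
have [H|H] := leP (fine (mu (ball x a)) / 2) (pr mut (ev X 0 (starts_in Wr))) => HS.
  by exists Wr; split => // w [].
by exists Wl; split => //; [move=> w []|lra].
Qed.

Lemma cover_time_le d (xs : seq R) (W : R -> set (seq A)) (t : coding_space s0) n :
  (0 < n)%N -> (forall y, rep y -> exists2 x, x \in xs & `|y - x| < d / 2) ->
  (forall x w, W x w -> Zw w `<=` ball x (d / 2)) ->
  (forall x, x \in xs -> ~ avoids X (W x) n t) ->
  (cover_time I Z f d (PiC t) <= n%:R%:E)%E.
Proof.
move=> n0 net WB hit; apply: ereal_inf_lbound; exists n => //; split => //.
have [tP rP] := PiP (t : Sigma I Z f).
split; first by move=> _ [k _ <-]; exact: repeller_iter.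
move=> y ry; have [x xxs yx] := net y ry.
have /existsNP[p /not_implyP[pn /contrapT[w Ww wt]]] := hit x xxs.
exists (iter p f (PiC t)); first by exists p => //; exact: ltnW.
have : Zw w (iter p f (PiC t)).
  rewrite -wt; apply: codes_word => //; last by case: (repeller_iter hf p rP).
  by move=> k; rewrite -iterD addnC; exact: tP.
move=> /(WB x w Ww)/real_ballP/andP[? ?]; move: yx; rewrite ltr_norml => /andP[? ?].
by rewrite ler_norml; apply/andP; split; lra.
Qed.

Lemma cover_time_ge0 d x : (0 <= cover_time I Z f d x)%E.
Proof. by apply/ereal_infP => _ [n _ <-]; rewrite lee_fin. Qed.

Import HBNNSimple.

(** The integral of the cover time is a supremum over the simple functions below
    it, and each of these is transported to the coding space by Pi. *)
Lemma expected_cover_time_le d (g : coding_space s0 -> \bar R) :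
  measurable_fun setT g -> (forall t, 0 <= g t)%E ->
  (forall t, cover_time I Z f d (PiC t) <= g t)%E ->
  (expected_cover_time I Z f mu d <= \int[mut]_t g t)%E.
Proof.
move=> mg g0 cg; rewrite /expected_cover_time ge0_integralE; last first.
  by move=> x _; exact: cover_time_ge0.
apply: ge_ereal_sup => _ [h hle <-].
have mP := measurable_Pi (s0:=s0) hf ha3.
rewrite -[sintegral _ _](_ : (\int[mu]_x (h x)%:E)%E = _); last first.
  by rewrite integral_nnsfun// patch_setT.
rewrite (eq_measure_integral (pushforward mut (@Pi _ _ I Z f : coding_space s0 -> measurableTypeR R))); last first.
  by move=> B mB _; exact: mut_Pi.
rewrite ge0_integral_pushforward//; last 2 first.
- by apply/measurable_EFinP; exact: measurable_funPT.
- by move=> y _; rewrite lee_fin.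
rewrite preimage_setT; apply: ge0_le_integral => //.
- by move=> t _; rewrite lee_fin.
- by apply: measurableT_comp => //; apply/measurable_EFinP.
move=> t _; apply: le_trans (cg t); apply: le_trans (hle _) _.
by rewrite /patch; case: ifP => // _; exact: cover_time_ge0.
Qed.

End cover_time_upper.

(** * The lower bound *)

Section cover_time_lower.
Context {R : realType} {A : countType}.
Variables (I : set R) (Z : A -> set R) (f : R -> R).
Hypothesis hf : piecewise_monotone_map I Z f.
Variable mu : probability (measurableTypeR R) R.
Hypothesis mu_invariant : f_invariant I Z f mu.
Implicit Types (B : set (measurableTypeR R)) (d : R) (n k : nat).
Local Notation rep := (repeller I Z f).

Let measurable_branch i : measurable (Z i : set (measurableTypeR R)).
Proof. by apply: is_interval_measurable; exact: (pmm_branch_interval hf). Qed.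

Lemma measurable_branch_preimage B : measurable B ->
  measurable (branch_domain Z `&` f @^-1` B : set (measurableTypeR R)).
Proof.
move=> mB; rewrite /branch_domain setI_bigcupl.
apply: countable_bigcupT_measurable => [|i]; first exact: countableP.
have mf := subspace_continuous_measurable_fun (measurable_branch i) (@pmm_continuous _ _ _ _ _ hf i).
exact: (mf (measurable_branch i) B mB).
Qed.

Lemma measurable_repeller : measurable (rep : set (measurableTypeR R)).
Proof.
pose fix H k : set (measurableTypeR R) :=
  if k is k'.+1 then I `&` (branch_domain Z `&` f @^-1` H k')
  else I `&` branch_domain Z.
have mI : measurable (I : set (measurableTypeR R)).
  by apply: is_interval_measurable; exact: (pmm_interval hf).
have mD : measurable (branch_domain Z : set (measurableTypeR R)).
  by apply: countable_bigcupT_measurable => [|i] //; exact: countableP.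
have mH k : measurable (H k).
  elim: k => [|k IH] /=; first exact: measurableI.
  by apply: measurableI => //; exact: measurable_branch_preimage.
rewrite (_ : rep = \bigcap_k H k); first exact: bigcapT_measurable.
apply/seteqP; split => x; last first.
  move=> Hx; split; first by case: (Hx 0%N Logic.I).
  have : forall k, H k x by move=> k; exact: Hx.
  move=> {}Hx k; have {Hx} : H k x by [].
  elim: k x => [|k IH] x /=; first by case.
  by move=> [_ [_ /IH]]; rewrite -iterS iterSr.
move=> rx k _; elim: k x rx => [|k IH] x rx /=.
  by case: rx => Ix /(_ 0%N).
split; first by case: rx.
by split; [case: rx => _ /(_ 0%N)|apply: IH; exact: repeller_map].
Qed.

Lemma mu_repeller : mu rep = 1%E.
Proof.
have := mu_invariant (@measurableT _ (measurableTypeR R)).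
by rewrite preimage_setT setIT => ->; exact: probability_setT.
Qed.

Lemma measurable_iter_preimage k B : measurable B ->
  measurable (rep `&` iter k f @^-1` B : set (measurableTypeR R)) /\
  mu (rep `&` iter k f @^-1` B) = mu B.
Proof.
move=> mB; have mr := measurable_repeller.
elim: k => [|k [mE muE]].
  have mrB : measurable (rep `&` B : set (measurableTypeR R)) by exact: measurableI.
  split => //; have E : B = (rep `&` B) `|` (B `\` rep).
    by rewrite setIC setUIDK.
  rewrite [RHS](_ : _ = mu ((rep `&` B) `|` (B `\` rep))); last by rewrite -E.
  rewrite measureU0//; first exact: measurableD.
  apply/eqP; rewrite -measure_le0; apply: le_trans (_ : mu (~` rep) <= _)%E.
    by apply: le_measure; rewrite ?inE; [exact: measurableD|exact: measurableC|move=> x []].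
  by rewrite probability_setC// mu_repeller subee.
have -> : rep `&` iter k.+1 f @^-1` B = rep `&` f @^-1` (rep `&` iter k f @^-1` B).
  apply/seteqP; split => x; rewrite /preimage /= -iterS iterSr.
    by move=> [rx ?]; split => //; split => //; exact: repeller_map.
  by move=> [rx [_ ?]].
rewrite mu_invariant//; split => //.
have -> : rep `&` f @^-1` (rep `&` iter k f @^-1` B) =
    rep `&` (branch_domain Z `&` f @^-1` (rep `&` iter k f @^-1` B)).
  rewrite setIA; congr (_ `&` _); apply/seteqP; split => x; last by case.
  by move=> rx; split => //; case: rx => _ /(_ 0%N).
by apply: measurableI => //; exact: measurable_branch_preimage.
Qed.

Definition misses B n : set (measurableTypeR R) :=
  [set x | rep x /\ forall k, (k < n)%N -> ~ B (iter k f x)].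

Lemma mu_misses B n : measurable B -> measurable (misses B n) /\
  1 - n%:R * pr mu B <= pr mu (misses B n).
Proof.
move=> mB; have mr := measurable_repeller; elim: n => [|n [mM IH]].
  have -> : misses B 0 = rep by apply/seteqP; split => x // [].
  by rewrite mul0r subr0 /pr mu_repeller.
have [mP muP] := measurable_iter_preimage n mB.
have E : misses B n.+1 = misses B n `\` (rep `&` iter n f @^-1` B).
  apply/seteqP; split => x.
    move=> [rx H]; split; first by split => // k kn; apply: H; exact: leqW.
    by move=> [_]; exact: H.
  move=> [[rx H] nB]; split => // k; rewrite ltnS leq_eqVlt => /orP[/eqP ->|/H//] Bx.
  exact: nB.
have mM' : measurable (misses B n.+1) by rewrite E; exact: measurableD.
split => //; have := pr_split mu mM mP; rewrite -E.
have : pr mu (misses B n `&` (rep `&` iter n f @^-1` B)) <= pr mu B.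
  rewrite [leRHS](_ : _ = pr mu (rep `&` iter n f @^-1` B)); last by rewrite /pr muP.
  by apply: le_pr => //; exact: measurableI.
rewrite -natr1 mulrDl mul1r; move: IH.
by move: (pr _ _) (pr _ _) (pr _ _) (pr _ _) => a b c e; lra.
Qed.

Import HBNNSimple.

(** The scaled indicator of G is one of the simple functions below tau whose
    integrals define the integral of tau. *)
Lemma integral_ge_on (tau : R -> \bar R) (G : set (measurableTypeR R)) (c : R) :
  measurable G -> G `<=` rep -> 0 <= c -> (forall x, (0 <= tau x)%E) ->
  (forall x, G x -> (c%:E <= tau x)%E) ->
  ((c * pr mu G)%:E <= \int[mu]_(x in rep) tau x)%E.
Proof.
move=> mG Gr c0 t0 ct; rewrite ge0_integralE//; apply: ereal_sup_ubound.
pose h := scale_nnsfun (indic_nnsfun R mG) c0.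
have hE x : h x = c * \1_G x by [].
exists h.
  move=> x; rewrite /patch hE indicE; case: (boolP (x \in G)) => [|_].
    by rewrite inE => Gx; rewrite mem_set ?mulr1; [exact: ct|exact: Gr].
  by rewrite mulr0; case: ifP.
have E := integral_nnsfun mu (@measurableT _ _) h; rewrite patch_setT in E.
rewrite -E; under eq_integral => x _ do rewrite hE EFinM.
rewrite ge0_integralZl_EFin//; last by apply/measurable_EFinP; exact: measurable_indic.
rewrite integral_indic// setIT EFinM; congr (_ * _)%E.
exact: prE.
Qed.

(** The orbit has to enter a ball B of measure b < 2 M that contains a whole
    d-ball centred in the repeller; before time 1 / (2 b) it misses B with
    probability at least 1/2.  The cover time is also at least 1, which
    takes care of the balls with b > 1/2. *)
Lemma expected_cover_time_ge d (eps : R) : 0 < d -> 0 < eps -> eps < 1 ->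
  supp mu !=set0 -> 0 < min_ball mu (d / eps) ->
  ((16^-1 / min_ball mu (d / eps))%:E <= expected_cover_time I Z f mu d)%E.
Proof.
move=> d0 e0 e1 s0 M0; set M := min_ball _ _ in M0 *.
have [x0 sx0 bM] := @min_ball_near _ mu (d / eps) 2 ltac:(lra) s0 M0.
rewrite -/M in bM.
set B := ball x0 (d / eps) in bM; set b := fine (mu B) in bM.
have mB : measurable (B : set (measurableTypeR R)) by exact: measurable_ball.
have de : d < d / eps by rewrite ltr_pdivlMr// gtr_pMr.
have [x1 rx1 /real_ballP/andP[x10 x11]] : exists2 x1, rep x1 & ball x0 (d / eps - d) x1.
  apply: contrapT => no; have : (0 < mu (ball x0 (d / eps - d)))%E.
    by apply: sx0; rewrite subr_gt0.
  apply/negP; rewrite -leNgt -(_ : mu (~` rep) = 0%E).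
    apply: le_measure; rewrite ?inE.
    - exact: measurable_ball.
    - by apply: measurableC; exact: measurable_repeller.
    by move=> z yz Dz; apply: no; exists z.
  by rewrite probability_setC ?mu_repeller ?subee//; exact: measurable_repeller.
have b0 : 0 < b.
  by rewrite -lte_fin -(prE mu mB); apply: sx0; rewrite (lt_trans d0).
pose y := (2 * b)^-1; have y0 : 0 < y by rewrite invr_gt0 mulr_gt0.
pose n := Num.truncn y; pose c : R := (maxn 1 n)%:R.
have [mG muG] := mu_misses n mB.
have nb : n%:R * b <= 2^-1.
  have : n%:R <= y by rewrite truncn_le ltW.
  by rewrite /y invfM -ler_pdivlMr.
have cy : y / 2 <= c.
  have : y < n.+1%:R by exact: truncnS_gt.
  have : n.+1%:R <= 2 * c.
    by rewrite /c -natrM ler_nat; clear; lia.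
  lra.
have HG x : misses B n x -> (c%:E <= cover_time I Z f d x)%E.
  move=> [rx Hx]; apply/ereal_infP => _ [k [k1 [_ dense]] <-].
  rewrite lee_fin ler_nat geq_max k1 /=.
  have [_ [j jk <-] xd] := dense x1 rx1.
  apply: leq_trans jk; rewrite leqNgt; apply/negP => jn; apply: (Hx j jn).
  apply/real_ballP; move: xd; rewrite ler_norml => /andP[? ?].
  by apply/andP; split; lra.
apply: le_trans (integral_ge_on mG _ _ _ HG); last 3 first.
- by move=> x [].
- by rewrite ler0n.
- by move=> x; exact: cover_time_ge0.
have G2 : 2^-1 <= pr mu (misses B n) by rewrite -[pr mu B]/b in muG; lra.
rewrite lee_fin; apply: (@le_trans _ _ (y / 2 * 2^-1)).
  rewrite ler_pdivrMr// [leRHS](_ : _ = y * M / 4); last by field.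
  rewrite /y.
  have : (2 * b)^-1 * M >= (2 * b)^-1 * (b / 2) by rewrite ler_wpM2l ?invr_ge0 ?mulr_ge0 ?(ltW b0)//; lra.
  have -> : (2 * b)^-1 * (b / 2) = 4^-1 by field; rewrite gt_eqF.
  by move: (_ * M) => a; lra.
by apply: ler_pM => //; rewrite ?divr_ge0 ?(ltW y0)//.
Qed.

End cover_time_lower.

(** * The upper bound *)

Lemma pr_exists_le d (T : measurableType d) (R : realType) (P : probability T R)
  (U : eqType) (F : U -> set T) (c : R) (xs : seq U) :
  (forall x, x \in xs -> measurable (F x) /\ pr P (F x) <= c) ->
  let G := [set t | exists2 x, x \in xs & F x t] in
  measurable G /\ pr P G <= (size xs)%:R * c.
Proof.
elim: xs => [|x xs IH] H /=.
  rewrite (_ : mkset _ = set0); last by apply/seteqP; split => t // [].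
  by rewrite pr_set0 mul0r; split => //; exact: measurable0.
have [mx px] := H x (mem_head _ _).
have [mG pG] := IH (fun y yxs => H y (mem_behead (s := x :: xs) yxs)).
rewrite (_ : mkset _ = F x `|` [set t | exists2 x, x \in xs & F x t]); last first.
  apply/seteqP; split => t.
    move=> [y]; rewrite inE => /orP[/eqP ->|yxs] Ft; first by left.
    by right; exists y.
  by move=> [Ft|[y yxs Ft]]; [exists x|exists y] => //; rewrite inE ?eqxx ?yxs ?orbT.
split; first exact: measurableU.
apply: le_trans (prU_le P mx mG) _.
by rewrite -natr1 mulrDl mul1r addrC lerD.
Qed.

(** This is where the logarithm of the theorem comes from: N events of
    probability q ^ r become negligible as soon as r is of order ln N. *)
Lemma expr_log_le (R : realType) (q : R) : 0 < q -> q < 1 ->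
  exists2 a : R, 0 < a & forall N : R, 1 <= N ->
  exists r : nat, [/\ (0 < r)%N, r%:R <= ln N / a + 1 & N * q ^+ r <= 1].
Proof.
move=> q0 q1; exists (- ln q); first by rewrite oppr_gt0 ln_lt0// q0.
have a0 : 0 < - ln q by rewrite oppr_gt0 ln_lt0// q0.
move=> N N1; have N0 : 0 < N by exact: lt_le_trans N1.
have y0 : 0 <= ln N / - ln q by rewrite divr_ge0 ?ln_ge0// ltW.
exists (Num.truncn (ln N / - ln q)).+1; split=> //.
  by rewrite -natr1 lerD2r truncn_le.
have := truncnS_gt (ln N / - ln q); set r := _.+1.
rewrite ltr_pdivrMr// => H.
have -> : q ^+ r = expR (r%:R * ln q) by rewrite expRM_natl lnK// posrE.
rewrite -{1}(lnK (x := N))// -expRD -[leRHS]expR0 ler_expR.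
by move: H; rewrite mulrN; lra.
Qed.

Section cover_time_bounds.
Context {R : realType} {A : countType}.
Variables (I : set R) (Z : A -> set R) (f phi : R -> R).
Hypothesis hf : piecewise_monotone_map I Z f.
Hypothesis ha3 : cond_a3 I Z f phi.
Variables (s0 : Sigma I Z f) (mut : probability (coding_space s0) R).
Variable mu : probability (measurableTypeR R) R.
Hypothesis mu1 : forall x : R, mu [set x] = 0%E.
Hypothesis mut_Pi : forall B : set (measurableTypeR R), measurable B ->
  mu B = mut (@Pi _ _ I Z f @^-1` B).
Hypothesis ha5 : cond_a5 mut.
Hypothesis ha6 : cond_a6 mut.
Local Notation rep := (repeller I Z f).
Local Notation X := (@itinerary _ _ I Z f s0).
Local Notation pr := (pr mut).

Lemma avoids_tail : exists K q : R, [/\ 0 < K, 0 < q, q < 1 &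
  forall (W : set (seq A)) (e := pr (ev X 0 (starts_in W))) L, chain W -> 0 < e ->
  K / e <= L%:R -> forall r, pr (avoids X W (r * L)) <= q ^+ r].
Proof.
have [C C1 pc] := pr_cat_quasi_bernoulli hf ha5.
have [j0 pg] := pr_gap_mixing ha6.
have [k [eta eta0 pw]] := pr_word_lt1 hf ha3 mu1 mut_Pi.
have mX := @measurable_itinerary _ _ I Z f s0.
have eta1 : eta <= 1.
  have := pw (mkseq (X s0) k) (size_mkseq _ _).
  by have := pr_ge0 mut (ev X 0 (starts (mkseq (X s0) k))); lra.
have k0 : (0 < k + j0)%N.
  rewrite addn_gt0; apply/orP; left; rewrite lt0n; apply/eqP => k0.
  have := pw [::] (esym k0); rewrite (_ : pr _ = 1); first by move=> ?; lra.
  by rewrite -(pr_setT mut); congr (pr _); apply/seteqP; split.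
have decay := pr_starts_decay mX pg eta0 pw.
have [||K [q [K0 q0 q1 H]]] := pr_avoids_le mX C1 pc pg _ _ k0 decay; [lra|lra|].
(* q is enlarged so that its logarithm makes sense *)
exists K, (Num.max q 2^-1); split => //.
- by rewrite lt_max invr_gt0 ltr0n orbT.
- by rewrite gt_max q1 /=; lra.
move=> W e L cW e0 KL r; apply: le_trans (H W L cW e0 KL r) _.
by apply: lerXn2r; rewrite ?nnegrE ?le_max ?q0 ?lexx//.
Qed.

Hypothesis supp_rep : rep `<=` supp mu.
Hypothesis mu_rep : mu rep = 1%E.
Hypothesis measurable_rep : measurable (rep : set (measurableTypeR R)).

Lemma min_ball_rep_gt0 d : 0 < d -> 0 < min_ball mu d.
Proof.
by apply: (min_ball_gt0 measurable_rep (pmm_bounded hf)) => // x [].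
Qed.

Lemma supp_nonempty : supp mu !=set0.
Proof. by have [_ rP] := PiP s0; exists (Pi s0); exact: supp_rep. Qed.

(** There are N = O(1 / d) balls of the net to visit, each missed for r * L steps
    with probability at most q ^ r, where L is of order 1 / M; the expected time
    to visit them all is O(L * ln N). *)
Lemma expected_cover_time_upper : exists C d0 : R, [/\ 0 < C, 0 < d0 &
  forall d, 0 < d -> d < d0 ->
  (expected_cover_time I Z f mu d <= (C / min_ball mu (4^-1 * d) * ln (1 / d))%:E)%E].
Proof.
have [K [q [K0 q0 q1 HK]]] := avoids_tail.
have [K1 K10 net] := finite_net (pmm_bounded hf).
have [a a0 Ha] := expr_log_le q0 q1.
have p0 : 0 < 1 - q by rewrite subr_gt0.
pose K2 := 2 * K1 + 1; have K21 : 1 <= K2 by rewrite /K2; lra.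
pose C2 := (ln K2 + 1) / a + 1 + 1 / (1 - q).
have C20 : 0 < C2.
  by rewrite /C2 addr_gt0 ?divr_gt0// ltr_wpDl// divr_ge0 ?(ltW a0)// addr_ge0 ?ln_ge0.
exists ((2 * K + 1) * C2), (expR (- 1)); split.
- by rewrite mulr_gt0//; lra.
- exact: expR_gt0.
move=> d d0 dlt; set M := min_ball mu (4^-1 * d).
have M0 : 0 < M by apply: min_ball_rep_gt0; rewrite mulr_gt0.
have M1 : M <= 1 by apply: min_ball_le1; exact: supp_nonempty.
have l1 : 1 <= ln (1 / d).
  have := dlt; rewrite -ltr_ln ?posrE ?expR_gt0// expRK div1r lnV ?posrE//; lra.
have d1 : d <= 1 by rewrite ltW// (lt_trans dlt)// -expR0 ltr_expR; lra.
have d2 : 0 < d / 2 by rewrite divr_gt0.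
have [xs [xsr xsN xs_net]] := net rep (d / 2) (fun x => @proj1 _ _) d2.
pose N := 2 * K1 / d + 1.
have {}xsN : (size xs)%:R <= N.
  by apply: le_trans xsN _; rewrite /N invfM invrK; lra.
have N1 : 1 <= N by rewrite /N lerDr divr_ge0 ?mulr_ge0 ?ltW.
have [r0 [r00 r0N Nq]] := Ha N N1.
have : forall x : R, exists W : set (seq A), [/\ chain W,
    (forall w, W w -> word_interval I Z f w `<=` ball x (d / 2)) &
    fine (mu (ball x (4^-1 * d))) / 2 <= pr (ev X 0 (starts_in W))].
  by move=> x; apply: (exists_target hf ha3 mut_Pi); lra.
move=> /choice[W HW].
pose L := (Num.truncn (2 * K / M)).+1.
have HL : 2 * K / M <= L%:R by rewrite ltW// truncnS_gt.
have KM0 : 0 <= 2 * K / M by rewrite divr_ge0 ?mulr_ge0// ltW.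
have LM : L%:R <= (2 * K + 1) / M.
  have -> : L%:R = (Num.truncn (2 * K / M))%:R + 1 :> R by rewrite natr1.
  rewrite [leRHS]mulrDl; apply: lerD; first by rewrite truncn_le.
  by rewrite div1r invf_ge1.
have mX := @measurable_itinerary _ _ I Z f s0.
pose B r := [set t | exists2 x, x \in xs & avoids X (W x) (r * L) t].
have HB r : measurable (B r) /\ pr (B r) <= (size xs)%:R * q ^+ r.
  apply: pr_exists_le => x xxs; split; first exact: (measurable_avoids mX).
  have [cW _ We] := HW x.
  have sx := supp_rep (xsr x xxs).
  have Me : M / 2 <= pr (ev X 0 (starts_in (W x))).
    by apply: le_trans We; have := min_ball_le (4^-1 * d) sx; rewrite -/M; lra.
  have e0 : 0 < pr (ev X 0 (starts_in (W x))) by apply: lt_le_trans Me; lra.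
  apply: HK => //; apply: le_trans HL.
  rewrite ler_pdivrMr// [leRHS]mulrAC ler_pdivlMr//.
  have : 0 <= K * (pr (ev X 0 (starts_in (W x))) - M / 2).
    by rewrite mulr_ge0 ?subr_ge0// ltW.
  by move: (pr _) => e; lra.
have tauB r t : (r0 <= r)%N -> ~ B r t ->
    (cover_time I Z f d (Pi (t : Sigma I Z f)) <= ((r * L)%:R)%:E)%E.
  move=> r0r nB; apply: (cover_time_le hf (xs := xs) (W := W)).
  - by rewrite muln_gt0 (leq_trans r00).
  - exact: xs_net.
  - by move=> x w; have [_ + _] := HW x; exact.
  - by move=> x xxs Bx; apply: nB; exists x.
have PB r : pr (B r) <= N * q ^+ r.
  by apply: le_trans (HB r).2 _; rewrite ler_wpM2r// exprn_ge0// ltW.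
have L0 : (0 < L)%N by [].
have N0 : 0 <= N by exact: le_trans N1.
have [g [mg g0 tg Ig]] := geometric_tail_majorant L0 N0 (ltW q0) q1
  (fun r => (HB r).1) PB tauB.
apply: le_trans (expected_cover_time_le hf ha3 mut_Pi mg g0 tg) _.
apply: le_trans Ig _; rewrite lee_fin.
have -> : (2 * K + 1) * C2 / M * ln (1 / d) = (2 * K + 1) / M * (C2 * ln (1 / d)).
  by ring.
apply: ler_pM => //.
  by rewrite addr_ge0// divr_ge0 ?(ltW p0)// mulr_ge0 ?exprn_ge0 ?(ltW q0)// (le_trans _ N1).
have lnN : ln N <= ln K2 + ln (1 / d).
  have K2p : 0 < K2 by exact: lt_le_trans K21.
  have Np : 0 < N by exact: lt_le_trans N1.
  have dp : 0 < 1 / d by rewrite divr_gt0.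
  rewrite -lnM ?posrE// ler_ln ?posrE//; last exact: mulr_gt0.
  have : 1 <= 1 / d by rewrite div1r invf_ge1.
  by rewrite /K2 /N -[2 * K1 / d]mulrA -div1r mulrDl mul1r; lra.
have lnK2 : 0 <= ln K2 by rewrite ln_ge0.
move: l1 lnN; move: (ln (1 / d)) => l l1 lnN.
have : ln N / a <= (ln K2 + 1) / a * l.
  rewrite mulrAC ler_wpM2r ?invr_ge0 ?(ltW a0)//.
  apply: le_trans lnN _; rewrite [leRHS]mulrDl.
  by apply: lerD; [rewrite ler_peMr|rewrite mul1r].
have : N * q ^+ r0 / (1 - q) <= 1 / (1 - q) * l.
  apply: le_trans (_ : 1 / (1 - q) <= _).
    by rewrite ler_wpM2r ?invr_ge0 ?(ltW p0).
  by rewrite ler_peMr// divr_ge0// ltW.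
rewrite /C2 2!mulrDl mul1r; lra.
Qed.

End cover_time_bounds.

(** * Rewriting the bounds with the Minkowski dimension *)

Section minkowski.
Context {R : realType}.
Variable mu : set R -> \bar R.
Implicit Types (s d eps : R).

(** The measure M of the minimal ball is d to the power ln M / ln d, and powers of
    d < 1 decrease in the exponent. *)
Lemma min_ball_powR s d : 0 < d -> d < 1 -> 0 < min_ball mu d ->
  d `^ (s + minkowski_err mu s d) <= min_ball mu d <=
  d `^ (s - minkowski_err mu s d).
Proof.
move=> d0 d1 M0; have lnd : ln d < 0 by rewrite ln_lt0// d0.
rewrite -{1 2}(lnK (x := min_ball mu d))// /powR gt_eqF// !ler_expR.
have -> : ln (min_ball mu d) = ln (min_ball mu d) / ln d * ln d.
  by rewrite divfK// lt_eqF.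
rewrite !ler_nM2r//; have := lexx (minkowski_err mu s d).
rewrite {1}/minkowski_err ler_distl => /andP[? ?].
by apply/andP; split; lra.
Qed.

Lemma powR_inv_min_ball_le s d eps : 0 < d -> 0 < eps -> d < eps -> eps < 1 ->
  0 < min_ball mu (d / eps) ->
  eps `^ s * d `^ (- s + minkowski_err mu s (d / eps)) <= (min_ball mu (d / eps))^-1.
Proof.
move=> d0 e0 de e1 M0.
have r0 : 0 < d / eps by rewrite divr_gt0.
have r1 : d / eps < 1 by rewrite ltr_pdivrMr// mul1r.
have /andP[_ H] := min_ball_powR s r0 r1 M0.
set e := minkowski_err _ _ _ in H *; have e_ge0 : 0 <= e by exact: normr_ge0.
rewrite -(lef_pV2) ?posrE ?invr_gt0 ?mulr_gt0 ?powR_gt0// invrK.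
apply: le_trans H _; rewrite invfM -!powRN /powR !gt_eqF// -expRD ler_expR.
rewrite lnM ?posrE ?invr_gt0// lnV ?posrE//.
have : 0 <= e * (- ln eps) by rewrite mulr_ge0// oppr_ge0 ln_le0// ltW.
by move: (ln d) (ln eps) => a b; lra.
Qed.

Lemma inv_min_ball_le_powR s d eps : 0 < d -> d < 1 -> 0 < eps -> eps < 1 ->
  minkowski_err mu s (eps * d) <= 1 -> 0 < min_ball mu (eps * d) ->
  (min_ball mu (eps * d))^-1 <=
  eps `^ (- s - 1) * d `^ (- s - minkowski_err mu s (eps * d)).
Proof.
move=> d0 d1 e0 e1 err1 M0.
have r0 : 0 < eps * d by rewrite mulr_gt0.
have r1 : eps * d < 1 by rewrite mulr_ilt1 ?ltW.
have /andP[H _] := min_ball_powR s r0 r1 M0.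
move: err1 H; set e := minkowski_err _ _ _ => err1 H.
rewrite -(lef_pV2) ?posrE ?invr_gt0 ?mulr_gt0 ?powR_gt0// invrK.
apply: le_trans H; rewrite invfM -!powRN /powR !gt_eqF// -expRD ler_expR.
rewrite lnM ?posrE//.
have : 0 <= (1 - e) * (- ln eps).
  by rewrite mulr_ge0 ?subr_ge0// oppr_ge0 ln_le0// ltW.
by move: (ln d) (ln eps) => a b; lra.
Qed.

Lemma minkowski_dim_unique s s' : is_minkowski_dim mu s ->
  is_minkowski_dim mu s' -> s = s'.
Proof. by apply: cvg_unique; exact: norm_hausdorff. Qed.

Lemma minkowski_err_le1 s : is_minkowski_dim mu s ->
  exists2 d1, 0 < d1 & forall d, 0 < d -> d < d1 -> minkowski_err mu s d <= 1.
Proof.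
move=> /cvgrPdist_le/(_ 1 ltr01)[d1 /= d10 H]; exists d1 => // d d0 dd1.
by apply: H => //=; rewrite sub0r normrN gtr0_norm.
Qed.

End minkowski.

Theorem theorem2p2 (R : realType) (A : countType)
  (I : set R) (Z : A -> set R) (f phi : R -> R)
  (m mu : probability (measurableTypeR R) R)
  (s0 : Sigma I Z f) (mut : probability (coding_space s0) R)
  (Cd : R) (n1 : nat)
  (hf : piecewise_monotone_map I Z f)
  (m_I : m I = 1%E)
  (m_nonatomic : nonatomic m)
  (m_hole : m (hole I Z) = 0%E)
  (m_conformal : conformal I Z f phi m)
  (ha1 : cond_a1 I Z f phi Cd)
  (ha2 : cond_a2 I Z f phi)
  (ha3 : cond_a3 I Z f phi)
  (hn1 : contraction_time I Z f phi Cd n1)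
  (ha4 : cond_a4 I Z f m n1)
  (mu_invariant : f_invariant I Z f mu)
  (mu_ac : mu `<< m)
  (mu_density : bv_density_bounded_below I m mu)
  (mut_Pi : forall B : set (measurableTypeR R), measurable B ->
     mu B = mut (@Pi _ _ I Z f @^-1` B))
  (ha5 : cond_a5 mut)
  (ha6 : cond_a6 mut)
  (hDiam : cond_Diam I m)
  (hBD : cond_BD I Z f)
  (hAdj : cond_Adj I Z f mu) :
  exists c C eps : R,
    [/\ 0 < c, c < C, 0 < eps,
        \forall d \near 0^'+,
          ((c / min_ball mu (d / eps))%:E <= expected_cover_time I Z f mu d
             <= (C / min_ball mu (eps * d) * ln (1 / d))%:E)%E &
        forall s : R, is_minkowski_dim mu s ->
        \forall d \near 0^'+,
          ((c * d `^ (- s + minkowski_err mu s (d / eps)))%:E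
             <= expected_cover_time I Z f mu d
             <= (C * d `^ (- s - minkowski_err mu s (eps * d)) * ln (1 / d))%:E)%E].
Proof.
have mu1 x : mu [set x] = 0%E.
  have m1 : m [set x] = 0%E.
    apply: contrapT => /eqP mx; have mx0 : (0 < m [set x])%E by rewrite lt0e mx measure_ge0.
    have [E [_ /subset_set1[]-> /andP[]]] := m_nonatomic _ (measurable_set1 x) mx0.
      by rewrite measure0 ltxx.
    by rewrite ltxx.
  by have /null_content_dominatesP := mu_ac; apply; first exact: measurable_set1.
have rep_supp := repeller_sub_supp hf ha3 hAdj.
have mr := measurable_repeller hf; have mur := mu_repeller mu_invariant.
have M_gt0 := min_ball_rep_gt0 hf rep_supp mur mr.
have supp0 := supp_nonempty s0 rep_supp.
have [C0 [d0 [C00 d00 upper]]] :=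
  expected_cover_time_upper hf ha3 mu1 mut_Pi ha5 ha6 rep_supp mur mr.
pose eps : R := 4^-1.
have e0 : 0 < eps by rewrite invr_gt0.
have e1 : eps < 1 by rewrite invf_lt1// ltr1n.
have lower d (dp : 0 < d) := expected_cover_time_ge hf mu_invariant dp e0 e1 supp0
  (M_gt0 _ (divr_gt0 dp e0)).
(* the constants of the second estimate depend on the dimension, which is
   unique when it exists *)
have [s Hs] : exists s, forall s', is_minkowski_dim mu s' -> s' = s.
  have [[s dims]|no] := pselect (exists s, is_minkowski_dim mu s).
    by exists s => s' dims'; exact: minkowski_dim_unique dims' dims.
  by exists 0 => s' dims'; exfalso; apply: no; exists s'.
pose c : R := 16^-1 * Num.min 1 (eps `^ s).
pose C : R := C0 * Num.max 1 (eps `^ (- s - 1)) + 1.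
have c0 : 0 < c by rewrite mulr_gt0 ?invr_gt0// lt_min ltr01 powR_gt0.
have c16 : c <= 16^-1 by rewrite /c ler_piMr ?invr_ge0// ge_min lexx.
have C0C : C0 <= C by rewrite /C ler_wpDr// ler_peMr ?(ltW C00)// le_max lexx.
have C1 : 1 <= C by rewrite /C lerDr mulr_ge0 ?(ltW C00)// le_max ler01.
exists c, C, eps; split => //.
- by apply: le_lt_trans c16 _; apply: lt_le_trans C1; lra.
- near=> d.
  have dp : 0 < d by near: d; exact: nbhs_right_gt.
  have dd0 : d < Num.min d0 1 by near: d; apply: nbhs_right_lt; rewrite lt_min d00 ltr01.
  move: dd0; rewrite lt_min => /andP[dd0 d1].
  have l0 : 0 <= ln (1 / d) by rewrite ln_ge0// div1r invf_ge1// ltW.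
  apply/andP; split.
    apply: le_trans (lower d dp); rewrite lee_fin ler_wpM2r// invr_ge0 ltW//.
    exact/M_gt0/divr_gt0.
  apply: le_trans (upper d dp dd0) _; rewrite lee_fin ler_wpM2r// ler_wpM2r//.
  by rewrite invr_ge0 ltW// M_gt0// mulr_gt0.
move=> s' dims'; have s's := Hs s' dims'; move: dims'; rewrite s's => dims.
have [d2 d20 err1] := minkowski_err_le1 dims.
near=> d.
have dp : 0 < d by near: d; exact: nbhs_right_gt.
have : d < Num.min (Num.min d0 d2) eps.
  by near: d; apply: nbhs_right_lt; rewrite !lt_min d00 d20.
rewrite !lt_min => /andP[/andP[dd0 dd2] de].
have d1 : d < 1 by exact: lt_trans e1.
have l0 : 0 <= ln (1 / d) by rewrite ln_ge0// div1r invf_ge1// ltW.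
apply/andP; split.
  apply: le_trans (lower d dp); rewrite lee_fin.
  have Mp : 0 < min_ball mu (d / eps) by exact/M_gt0/divr_gt0.
  have := powR_inv_min_ball_le s dp e0 de e1 Mp.
  move=> /(ler_wpM2l (_ : 0 <= 16^-1)) H.
  apply: le_trans (H _); last by rewrite invr_ge0.
  by rewrite mulrA ler_wpM2r ?powR_ge0// /c ler_wpM2l ?invr_ge0// ge_min lexx orbT.
apply: le_trans (upper d dp dd0) _; rewrite lee_fin ler_wpM2r//.
have Mp : 0 < min_ball mu (eps * d) by apply: M_gt0; rewrite mulr_gt0.
have err : minkowski_err mu s (eps * d) <= 1.
  by apply: err1; rewrite ?mulr_gt0// (le_lt_trans _ dd2)// ger_pMl// ltW.
have H := inv_min_ball_le_powR dp d1 e0 e1 err Mp.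
apply: le_trans (ler_wpM2l (ltW C00) H) _.
rewrite mulrA ler_wpM2r ?powR_ge0// /C ler_wpDr// ler_wpM2l ?(ltW C00)//.
by rewrite le_max lexx orbT.
Unshelve. all: by end_near.
Qed.
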